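(* Let $S$ be a set of $n$ axis-aligned weighted rectangles in the plane such that $\mathrm{diam}(S)$ is bounded by a constant and each rectangle has width and height at least $1$. Then an independent set $I^*\subseteq S$ of the intersection graph of $S$ with $6\,w(I^* )\ge w(\mathit{OPT})$, where $\mathit{OPT}$ is a maximum-weight independent set of that graph, can be computed in $O(n)$ time on the real-RAM.
   Context: The intersection graph of $S$ has a vertex per rectangle, adjacent iff the rectangles intersect; an independent set is a set of pairwise non-intersecting rectangles. Each rectangle $R$ has a real weight $w(R)$ and $w(X)=\sum_{R\in X}w(R)$. $\mathrm{diam}(S)$ is the maximum Euclidean distance between two vertices (corners) of rectangles in $S$. *)

(* Defs.v *)
From HB Require Import structures.
From mathcomp Require Export all_boot all_order all_algebra.
From mathcomp Require Export finmap.
From mathcomp Require Export all_classical all_reals all_analysis.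
Export Order.TTheory GRing.Theory Num.Theory.
Export numFieldNormedType.Exports.

Set Implicit Arguments.
Unset Strict Implicit.
Unset Printing Implicit Defensive.

Local Open Scope classical_set_scope.
Local Open Scope ring_scope.

Section Rectangles.
Variable R : realType.

Record rect := Rect { xmin : R; xmax : R; ymin : R; ymax : R }.

Definition rect_tuple (r : rect) := (xmin r, xmax r, ymin r, ymax r).
Definition tuple_rect (t : R * R * R * R) :=
  let: (a, b, c, d) := t in Rect a b c d.
Lemma rect_tupleK : cancel rect_tuple tuple_rect.
Proof. by case. Qed.
HB.instance Definition _ := Choice.copy rect (can_type rect_tupleK).

Definition width (r : rect) : R := xmax r - xmin r.
Definition height (r : rect) : R := ymax r - ymin r.

(* Rectangles are closed: touching rectangles intersect. *)
Definition region (r : rect) : set (R * R) :=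
  [set p | xmin r <= p.1 <= xmax r /\ ymin r <= p.2 <= ymax r].

Definition intersects (r1 r2 : rect) : Prop :=
  region r1 `&` region r2 !=set0.

Definition corners (r : rect) : seq (R * R) :=
  [:: (xmin r, ymin r); (xmin r, ymax r);
      (xmax r, ymin r); (xmax r, ymax r)].

Definition dist (p q : R * R) : R :=
  Num.sqrt ((p.1 - q.1) ^+ 2 + (p.2 - q.2) ^+ 2).

(* Distances are nonnegative, so the default value 0 of the maximum only
   matters for the empty set. *)
Definition diam (S : {fset rect}) : R :=
  let vs := flatten [seq corners r | r <- S] in
  \big[Num.max/0]_(p <- vs) \big[Num.max/0]_(q <- vs) dist p q.

Definition adjacent (S : {fset rect}) (r1 r2 : rect) : Prop :=
  [/\ r1 \in S, r2 \in S, r1 <> r2 & intersects r1 r2].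

Definition independent (S I : {fset rect}) : Prop :=
  (I `<=` S)%fset /\ {in I &, forall r1 r2, ~ adjacent S r1 r2}.

Definition weight (w : rect -> R) (I : {fset rect}) : R :=
  \sum_(r <- I) w r.

Definition max_independent (S : {fset rect}) (w : rect -> R)
    (OPT : {fset rect}) : Prop :=
  independent S OPT /\
  forall J, independent S J -> weight w J <= weight w OPT.

End Rectangles.

(* A unit-cost real-RAM in the style of Preparata-Shamos and of
   Erickson-van der Hoog-Miltzow: a program has access to an array of natural
   numbers (used for counters and addresses) and an array of reals, both
   infinite and both with indirect addressing.  Reals can be added,
   subtracted, multiplied, divided and compared, but not rounded or otherwise
   converted to integers.  To keep the unit-cost measure realistic, there is no
   multiplication of integers; the literals of a program are natural numbers,
   so that no real constant can serve as an oracle. *)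
Inductive instr :=
| IConst of nat & nat          (* nats[i] := k *)
| IMove of nat & nat           (* nats[i] := nats[j] *)
| ILoad of nat & nat           (* nats[i] := nats[nats[j]] *)
| IStore of nat & nat          (* nats[nats[i]] := nats[j] *)
| IAdd of nat & nat & nat      (* nats[i] := nats[j] + nats[k] *)
| ISub of nat & nat & nat      (* nats[i] := nats[j] - nats[k], truncated *)
| RConst of nat & nat          (* reals[i] := k *)
| RCast of nat & nat           (* reals[i] := nats[j] *)
| RMove of nat & nat           (* reals[i] := reals[j] *)
| RLoad of nat & nat           (* reals[i] := reals[nats[j]] *)
| RStore of nat & nat          (* reals[nats[i]] := reals[j] *)
| RAdd of nat & nat & nat      (* reals[i] := reals[j] + reals[k] *)
| RSub of nat & nat & nat
| RMul of nat & nat & nat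
| RDiv of nat & nat & nat      (* with x / 0 = 0 *)
| Jump of nat                  (* goto l *)
| JumpIEq of nat & nat & nat   (* if nats[i] = nats[j] goto l *)
| JumpILt of nat & nat & nat   (* if nats[i] < nats[j] goto l *)
| JumpREq of nat & nat & nat   (* if reals[i] = reals[j] goto l *)
| JumpRLt of nat & nat & nat   (* if reals[i] < reals[j] goto l *)
| Halt.

Definition program := seq instr.

Section Machine.
Variable R : realType.

Record config :=
  Config { pc : nat; nats : nat -> nat; reals : nat -> R }.

Definition upd (T : Type) (f : nat -> T) (i : nat) (v : T) : nat -> T :=
  fun j => if j == i then v else f j.

Definition set_nat (c : config) (i v : nat) : config :=
  Config (pc c).+1 (upd (nats c) i v) (reals c).

Definition set_real (c : config) (i : nat) (v : R) : config :=
  Config (pc c).+1 (nats c) (upd (reals c) i v).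

Definition goto_if (b : bool) (c : config) (l : nat) : config :=
  Config (if b then l else (pc c).+1) (nats c) (reals c).

(* None means that the machine has halted. *)
Definition exec (i : instr) (c : config) : option config :=
  let W := nats c in
  let X := reals c in
  match i with
  | IConst i k => Some (set_nat c i k)
  | IMove i j => Some (set_nat c i (W j))
  | ILoad i j => Some (set_nat c i (W (W j)))
  | IStore i j => Some (set_nat c (W i) (W j))
  | IAdd i j k => Some (set_nat c i (W j + W k)%N)
  | ISub i j k => Some (set_nat c i (W j - W k)%N)
  | RConst i k => Some (set_real c i k%:R)
  | RCast i j => Some (set_real c i (W j)%:R)
  | RMove i j => Some (set_real c i (X j))
  | RLoad i j => Some (set_real c i (X (W j)))
  | RStore i j => Some (set_real c (W i) (X j))
  | RAdd i j k => Some (set_real c i (X j + X k))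
  | RSub i j k => Some (set_real c i (X j - X k))
  | RMul i j k => Some (set_real c i (X j * X k))
  | RDiv i j k => Some (set_real c i (X j / X k))
  | Jump l => Some (goto_if true c l)
  | JumpIEq i j l => Some (goto_if (W i == W j) c l)
  | JumpILt i j l => Some (goto_if (W i < W j)%N c l)
  | JumpREq i j l => Some (goto_if (X i == X j) c l)
  | JumpRLt i j l => Some (goto_if (X i < X j) c l)
  | Halt => None
  end.

(* Leaving the program text halts as well. *)
Definition step (P : program) (c : config) : option config :=
  exec (nth Halt P (pc c)) c.

(* run P t c = Some c' iff P started in c halts in c' after at most t steps. *)
Fixpoint run (P : program) (t : nat) (c : config) : option config :=
  match step P c, t with
  | None, _ => Some c
  | Some _, 0%N => None
  | Some c', t'.+1 => run P t' c'
  end.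

(* The rectangles are stored one after the other, in the order s, in the real
   memory, five cells each, and their number in the first integer cell; all
   other cells are 0. *)
Definition input (s : seq (rect R)) (w : rect R -> R) : config :=
  Config 0
    (upd (fun=> 0%N) 0 (size s))
    (nth 0 (flatten
       [seq [:: xmin r; xmax r; ymin r; ymax r; w r] | r <- s])).

(* A final configuration encodes I by the indices in s of its elements, each
   listed once, in nats[1], ..., nats[m], where m = nats[0]. *)
Definition outputs (s : seq (rect R)) (c : config) (I : {fset rect R}) : Prop :=
  exists2 t : seq (rect R), perm_eq t I &
    [seq onth s (nats c j) | j <- iota 1 (nats c 0)] = [seq Some r | r <- t].

End Machine.

(* Main.v *)
(* Idea. Two members of an optimal independent set conflict if their x-ranges
   overlap and their vertical gap is less than 1. As heights are at least 1, each
   rectangle has at most two conflicting rectangles starting further left, one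
   above and one below; so the conflict graph is 3-colourable, and some colour
   class X has at least a third of the optimal weight. Bounded diameter bounds
   the size of X by a constant K.

   Let delta = M/(2K), M being the maximum weight. For each member of X, taken by
   increasing right side, guess the rows of a unit grid that contain its lower
   and upper sides and its weight rounded down to a multiple of delta. There are
   constantly many guesses, and the program tries them all. Given a guess, choose
   for each member, in one pass over the input, the leftmost-ending rectangle
   which fits it and lies to the right of the previously chosen ones that the
   grid does not separate from it vertically. Since X has no conflicts, an
   exchange argument shows that the greedy choice never fails on the guess made
   from X. Rounding costs at most K * delta = M/2, hence at most half of the
   larger of M and w(X). *)
Require Import Defs.
From mathcomp Require Import zify lra.

Set Implicit Arguments.
Unset Strict Implicit.
Unset Printing Implicit Defensive.

Local Open Scope classical_set_scope.
Local Open Scope ring_scope.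

(** * A structured language and its compilation *)

(* [Guard v i j s] runs [s] iff the truth value of reals[i] < reals[j] is [v].
   [For s] runs [s] nats[0] times, with counter nats[1]; it sets nats[2] to 1. *)
Inductive stmt :=
| Atom of instr
| Skip
| Seq of stmt & stmt
| Guard of bool & nat & nat & stmt
| For of stmt.

Fixpoint len (s : stmt) : nat :=
  match s with
  | Atom _ => 1
  | Skip => 0
  | Seq s1 s2 => len s1 + len s2
  | Guard _ _ _ s => (len s).+2
  | For s => len s + 6
  end.

Fixpoint compile (b : nat) (s : stmt) : program :=
  match s with
  | Atom i => [:: i]
  | Skip => [::]
  | Seq s1 s2 => compile b s1 ++ compile (b + len s1) s2
  | Guard v i j s =>
      let e := (b.+2 + len s)%N in
      JumpRLt i j (if v then b.+2 else e) :: Jump (if v then e else b.+2)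
        :: compile b.+2 s
  | For s =>
      [:: IConst 1 0; IConst 2 1; JumpILt 1 0 b.+4; Jump (b.+4 + len s).+2]
        ++ compile b.+4 s ++ [:: IAdd 1 1 2; Jump b.+2]
  end.

Lemma size_compile b s : size (compile b s) = len s.
Proof.
elim: s b => //= [s1 IH1 s2 IH2|v i j s IH|s IH] b.
- by rewrite size_cat IH1 IH2.
- by rewrite IH.
- by rewrite size_cat IH /=; lia.
Qed.

Definition atomic (i : instr) : bool :=
  match i with
  | IStore _ _ | Jump _ | JumpIEq _ _ _ | JumpILt _ _ _
  | JumpREq _ _ _ | JumpRLt _ _ _ | Halt => false
  | _ => true
  end.

Definition iwrites (i : instr) : seq nat :=
  match i with
  | IConst i _ | IMove i _ | ILoad i _ | IAdd i _ _ | ISub i _ _ => [:: i]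
  | _ => [::]
  end.

Definition rwrites (i : instr) : seq nat :=
  match i with
  | RConst i _ | RCast i _ | RMove i _ | RLoad i _ | RAdd i _ _
  | RSub i _ _ | RMul i _ _ | RDiv i _ _ => [:: i]
  | _ => [::]
  end.

Definition no_rstore (i : instr) : bool := if i is RStore _ _ then false else true.

Fixpoint all_atoms (p : pred instr) (s : stmt) : bool :=
  match s with
  | Atom i => p i
  | Skip => true
  | Seq s1 s2 => all_atoms p s1 && all_atoms p s2
  | Guard _ _ _ s | For s => all_atoms p s
  end.

Fixpoint swrites (wr : instr -> seq nat) (lw : seq nat) (s : stmt) : seq nat :=
  match s with
  | Atom i => wr i
  | Skip => [::]
  | Seq s1 s2 => swrites wr lw s1 ++ swrites wr lw s2
  | Guard _ _ _ s => swrites wr lw s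
  | For s => lw ++ swrites wr lw s
  end.

Definition nat_writes := swrites iwrites [:: 1; 2]%N.
Definition real_writes := swrites rwrites [::].

Fixpoint loop_free (s : stmt) : bool :=
  match s with
  | Atom _ | Skip => true
  | Seq s1 s2 => loop_free s1 && loop_free s2
  | Guard _ _ _ s => loop_free s
  | For _ => false
  end.

(** Loops are not nested, which keeps the running time linear, and their bodies preserve the bound,
    the counter and the unit held in cells 0, 1 and 2. *)
Fixpoint wf_loops (s : stmt) : bool :=
  match s with
  | Atom _ | Skip => true
  | Seq s1 s2 => wf_loops s1 && wf_loops s2
  | Guard _ _ _ s => wf_loops s
  | For s => loop_free s && ~~ has (mem [:: 0; 1; 2]%N) (nat_writes s)
  end.

(** A guard takes at most two jumps. A round of a loop adds a test, an increment and a jump back;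
    the remaining 4 steps are the two initialisations, the last test and the exit. *)
Fixpoint cost (s : stmt) (n : nat) : nat :=
  match s with
  | Atom _ => 1
  | Skip => 0
  | Seq s1 s2 => cost s1 n + cost s2 n
  | Guard _ _ _ s => (cost s n).+2
  | For s => n * (cost s n + 3) + 4
  end.

Lemma loop_free_cost s n n' : loop_free s -> cost s n = cost s n'.
Proof.
elim: s => //= [s1 IH1 s2 IH2 /andP[h1 h2]|v i j s IH h].
- by rewrite IH1 // IH2.
- by rewrite IH.
Qed.

Lemma loop_free_wf s : loop_free s -> wf_loops s.
Proof. by elim: s => //= s1 IH1 s2 IH2 /andP[/IH1-> /IH2->]. Qed.

Lemma wf_loops_cost s : wf_loops s ->
  exists a, forall n, (cost s n <= a * n.+1)%N.
Proof.
elim: s => /= [i _|_|s1 IH1 s2 IH2 /andP[/IH1[a1 h1] /IH2[a2 h2]]|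
               v i j s IH /IH[a h]|s IH /andP[lf _]].
- by exists 1%N => n; lia.
- by exists 0%N.
- by exists (a1 + a2)%N => n; have := h1 n; have := h2 n; nia.
- by exists (a + 2)%N => n; have := h n; nia.
- exists (cost s 0 + 7)%N => n; rewrite (loop_free_cost _ 0 lf); nia.
Qed.

(** * Denotational semantics and correctness of the compilation *)

Section Semantics.
Variable R : realType.
Definition memory : Type := (nat -> nat) * (nat -> R).
Implicit Types (m : memory) (s : stmt) (P : program).

Definition den_instr (i : instr) m : memory :=
  if exec i (Config 0 m.1 m.2) is Some c then (nats c, reals c) else m.

Definition set_ctr (v : nat) m : memory := (upd m.1 1 v, m.2).

Fixpoint den (s : stmt) (m : memory) : memory :=
  match s with
  | Atom i => den_instr i m
  | Skip => m
  | Seq s1 s2 => den s2 (den s1 m)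
  | Guard v i j s => if (m.2 i < m.2 j) == v then den s m else m
  | For s => iteri (m.1 0%N) (fun k m' => set_ctr k.+1 (den s m'))
                   (upd (upd m.1 1 0%N) 2 1%N, m.2)
  end.

Lemma updE (T : Type) (f : nat -> T) i v j :
  upd f i v j = if j == i then v else f j.
Proof. by []. Qed.

Lemma den_instr_nat i m r : atomic i -> r \notin iwrites i ->
  (den_instr i m).1 r = m.1 r.
Proof.
move=> a; case: i a => //= [i k|i k|i k|i k l|i k l] _;
  by rewrite inE => /negPf h; rewrite /den_instr /= updE h.
Qed.

Lemma den_instr_real i m r : atomic i -> no_rstore i -> r \notin rwrites i ->
  (den_instr i m).2 r = m.2 r.
Proof.
move=> a b; case: i a b => //= [i k|i k|i k|i k|i k l|i k l|i k l|i k l] _ _;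
  by rewrite inE => /negPf h; rewrite /den_instr /= updE h.
Qed.

Lemma den_nat s m r : all_atoms atomic s -> r \notin nat_writes s ->
  (den s m).1 r = m.1 r.
Proof.
elim: s m => [i|//|s1 IH1 s2 IH2|v i j s IH|s IH] m /=.
- exact: den_instr_nat.
- case/andP => a1 a2; rewrite /nat_writes /= mem_cat negb_or => /andP[h1 h2].
  by rewrite IH2 // IH1.
- by move=> a h; case: ifP => // _; exact: IH.
- move=> a; rewrite /nat_writes /= !inE !negb_or => /and3P[r1 r2 h].
  elim: (m.1 0%N) => [|k IHk] /=; first by rewrite !updE (negPf r1) (negPf r2).
  by rewrite updE (negPf r1) IH.
Qed.

Lemma den_real s m r : all_atoms atomic s -> all_atoms no_rstore s ->
  r \notin real_writes s -> (den s m).2 r = m.2 r.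
Proof.
elim: s m => [i|//|s1 IH1 s2 IH2|v i j s IH|s IH] m /=.
- exact: den_instr_real.
- case/andP => a1 a2 /andP[b1 b2].
  rewrite /real_writes /= mem_cat negb_or => /andP[h1 h2].
  by rewrite IH2 // IH1.
- by move=> a b h; case: ifP => // _; exact: IH.
- move=> a b h; elim: (m.1 0%N) => [//|k IHk] /=.
  by rewrite IH.
Qed.

Lemma for_ind s m (I : nat -> memory -> Prop) :
  I 0%N (upd (upd m.1 1 0%N) 2 1%N, m.2) ->
  (forall k m', (k < m.1 0%N)%N -> I k m' -> I k.+1 (set_ctr k.+1 (den s m'))) ->
  I (m.1 0%N) (den (For s) m).
Proof.
move=> I0 IS /=; have: (m.1 0 <= m.1 0)%N by [].
elim: {1 3 4}(m.1 0%N) => [|k IHk] //= lt; apply: IS => //.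
by apply: IHk; exact: ltnW.
Qed.

Fixpoint stepn P (t : nat) (c : config R) : option (config R) :=
  if t is t'.+1 then obind (stepn P t') (step P c) else Some c.

Lemma stepnD P t1 t2 c c' : stepn P t1 c = Some c' ->
  stepn P (t1 + t2) c = stepn P t2 c'.
Proof.
elim: t1 c => [|t1 IH] c /=; first by case=> ->.
by case: (step P c) => //= c1; exact: IH.
Qed.

Lemma run_stepn P t t' c c' : (t <= t')%N ->
  stepn P t c = Some c' -> step P c' = None -> run P t' c = Some c'.
Proof.
elim: t t' c => [|t IH] t' c le /=.
  by case=> -> h; case: t' {le} => [|t'] /=; rewrite h.
case e: (step P c) => [c1|] //= h1 h2.
by case: t' le => // t' le /=; rewrite e; exact: IH h1 h2.
Qed.

Definition code_at P (b : nat) (code : program) :=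
  forall k, (k < size code)%N -> nth Halt P (b + k) = nth Halt code k.

Lemma code_at_catl P b c1 c2 : code_at P b (c1 ++ c2) -> code_at P b c1.
Proof.
move=> h k lt; rewrite h ?nth_cat ?lt // size_cat.
exact: ltn_addr.
Qed.

Lemma code_at_catr P b c1 c2 :
  code_at P b (c1 ++ c2) -> code_at P (b + size c1) c2.
Proof.
move=> h k lt; rewrite -addnA h ?nth_cat; last by rewrite size_cat ltn_add2l.
by rewrite ltnNge leq_addr /= addKn.
Qed.

Lemma code_at_cons P b i c : code_at P b (i :: c) ->
  nth Halt P b = i /\ code_at P b.+1 c.
Proof.
move=> h; split; first by have := h 0%N isT; rewrite addn0.
by move=> k lt; have := h k.+1 lt; rewrite addnS.
Qed.

Lemma step_atomic P b i m : atomic i -> nth Halt P b = i ->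
  step P (Config b m.1 m.2) =
    Some (Config b.+1 (den_instr i m).1 (den_instr i m).2).
Proof. by move=> a e; rewrite /step /= e; case: i a {e}. Qed.

Definition reaches P (b : nat) (m : memory) (t b' : nat) (m' : memory) :=
  exists2 t', (t' <= t)%N &
    stepn P t' (Config b m.1 m.2) = Some (Config b' m'.1 m'.2).

Lemma reaches_refl P b m : reaches P b m 0 b m.
Proof. by exists 0%N. Qed.

Lemma reaches_trans P b m t1 b1 m1 t2 b2 m2 :
  reaches P b m t1 b1 m1 -> reaches P b1 m1 t2 b2 m2 ->
  reaches P b m (t1 + t2) b2 m2.
Proof.
move=> [u1 l1 h1] [u2 l2 h2]; exists (u1 + u2)%N; first exact: leq_add.
by rewrite (stepnD _ h1).
Qed.

Lemma reaches_weak P b m t t' b' m' : (t <= t')%N ->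
  reaches P b m t b' m' -> reaches P b m t' b' m'.
Proof. by move=> le [u l e]; exists u => //; exact: leq_trans le. Qed.

Lemma reaches_step P b m b' m' :
  step P (Config b m.1 m.2) = Some (Config b' m'.1 m'.2) ->
  reaches P b m 1 b' m'.
Proof. by move=> e; exists 1%N => //=; rewrite e. Qed.

(** The cost is evaluated at the value of [nats[0]] on entry. Hence the third hypothesis: either
    there is no loop to consult that cell or no statement writes it. *)
Lemma compile_correct P b s m : all_atoms atomic s -> wf_loops s ->
  (loop_free s || (0%N \notin nat_writes s)) ->
  code_at P b (compile b s) ->
  reaches P b m (cost s (m.1 0%N)) (b + len s) (den s m).
Proof.
elim: s b m => [i|//|s1 IH1 s2 IH2|v i j s IH|s IH] b m /=.
- move=> a _ _ /code_at_cons[e _]; rewrite addn1.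
  by apply: reaches_step; exact: step_atomic.
- by rewrite addn0 => *; exact: reaches_refl.
- case/andP => a1 a2 /andP[w1 w2] h c.
  have c1 := code_at_catl c; have := code_at_catr c.
  rewrite size_compile => c2; rewrite addnA.
  have [h1 h2] : (loop_free s1 || (0%N \notin nat_writes s1)) /\
                 (loop_free s2 || (0%N \notin nat_writes s2)).
    case/orP: h => [/andP[-> ->] //|].
    by rewrite /nat_writes /= mem_cat negb_or => /andP[-> ->]; rewrite !orbT.
  apply: reaches_trans (IH1 _ _ a1 w1 h1 c1) _.
  have -> : cost s2 (m.1 0%N) = cost s2 ((den s1 m).1 0%N).
    case/orP: h => [/andP[_ l2]|]; first exact: loop_free_cost.
    rewrite /nat_writes /= mem_cat negb_or => /andP[n1 _].
    by rewrite den_nat.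
  exact: IH2.
- move=> a w h /code_at_cons[e1 /code_at_cons[e2 c]].
  have -> : (b + (len s).+2 = b.+2 + len s)%N by lia.
  have c1 := IH _ m a w h c.
  have j1 : reaches P b m 1 (if (m.2 i < m.2 j)%R then if v then b.+2 else b.+2 + len s
        else b.+1)%N m by apply: reaches_step; rewrite /step /= e1; case: ifP.
  have j2 : reaches P b.+1 m 1 (if v then b.+2 + len s else b.+2)%N m.
    by apply: reaches_step; rewrite /step /= e2; case: ifP.
  case: (m.2 i < m.2 j) j1; case: v h e1 e2 j2 => h e1 e2 j2 j1 /=.
  + by apply: reaches_weak (reaches_trans j1 c1); lia.
  + by apply: reaches_weak j1; lia.
  + by apply: reaches_weak (reaches_trans j1 j2); lia.
  + by apply: reaches_weak (reaches_trans j1 (reaches_trans j2 c1)); lia.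
- move=> a /andP[lf nw] h0 c.
  have n0 : 0%N \notin nat_writes s.
    by apply: contra nw => n0; apply/hasP; exists 0%N.
  have n1 : 1%N \notin nat_writes s.
    by apply: contra nw => n1; apply/hasP; exists 1%N.
  have n2 : 2%N \notin nat_writes s.
    by apply: contra nw => n2; apply/hasP; exists 2%N.
  have [e0 /code_at_cons[e1 /code_at_cons[e2 /code_at_cons[e3 cc]]]] :=
    code_at_cons c.
  have cs := code_at_catl cc; have := code_at_catr cc.
  rewrite size_compile => /code_at_cons[e4 /code_at_cons[e5 _]].
  set n := m.1 0%N.
  pose m0 : memory := (upd (upd m.1 1 0%N) 2 1%N, m.2).
  pose F k m' := set_ctr k.+1 (den s m').
  have fr k : [/\ (iteri k F m0).1 0%N = n, (iteri k F m0).1 1%N = k &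
                  (iteri k F m0).1 2%N = 1%N].
    elim: k => [//|k [i0 i1 i2]]; split; rewrite /= updE //=.
      by rewrite den_nat.
    by rewrite den_nat.
  have pre : reaches P b m 2 b.+2 m0.
    apply: (reaches_trans (t1 := 1) (m1 := (upd m.1 1 0%N, m.2)) (b1 := b.+1)).
      by apply: reaches_step; rewrite /step /= e0.
    by apply: reaches_step; rewrite /step /= e1.
  have loop k : (k <= n)%N ->
    reaches P b.+2 m0 (k * (cost s n + 3)) b.+2 (iteri k F m0).
    elim: k => [_|k IHk lt]; first exact: reaches_refl.
    have [i0 i1 i2] := fr k.
    have -> : (k.+1 * (cost s n + 3) = k * (cost s n + 3) + (1 + (cost s n + (1 + 1))))%N.
      by nia.
    apply: reaches_trans (IHk (ltnW lt)) _.
    apply: (reaches_trans (b1 := b.+4) (m1 := iteri k F m0)).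
      by apply: reaches_step; rewrite /step /= e2 /= /goto_if /= i0 i1 lt.
    have := IH b.+4 (iteri k F m0) a (loop_free_wf lf) _ cs.
    rewrite lf i0 => /(_ isT) c1; apply: (reaches_trans c1).
    apply: (reaches_trans (b1 := (b.+4 + len s).+1) (m1 := iteri k.+1 F m0)).
      apply: reaches_step; rewrite /step /= e4 /= /set_nat /=.
      by rewrite !den_nat // i1 i2 addn1.
    by apply: reaches_step; rewrite /step /= e5.
  have [i0 i1 i2] := fr n.
  have -> : (n * (cost s n + 3) + 4 = 2 + (n * (cost s n + 3) + (1 + 1)))%N by lia.
  apply: (reaches_trans pre); apply: (reaches_trans (loop n (leqnn n))).
  apply: (reaches_trans (b1 := b.+3) (m1 := iteri n F m0)).
    by apply: reaches_step; rewrite /step /= e2 /= /goto_if /= i0 i1 ltnn.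
  apply: reaches_step; rewrite /step /= e3 /= /goto_if /=.
  by have -> : ((b.+4 + len s).+2 = b + (len s + 6))%N by lia.
Qed.

End Semantics.

(** * Disjoint rectangles of width and height at least 1 *)

Section Geometry.
Variable R : realType.
Implicit Types (r q : rect R) (s : seq (rect R)) (w : rect R -> R).

Definition fat r := (1 <= width r) && (1 <= height r).

Definition separated r q :=
  [|| xmax r < xmin q, xmax q < xmin r, ymax r < ymin q | ymax q < ymin r].

Lemma separated_sym r q : separated r q = separated q r.
Proof. by rewrite /separated !orbA [_ || (xmax q < _)]orbC -!orbA [_ || (ymax q < _)]orbC. Qed.

Lemma separated_not_intersects r q : separated r q -> ~ intersects r q.
Proof.
move=> h [[x y]] /= [] [/= hx hy] [/= hx' hy'].
by case/or4P: h => h; lra.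
Qed.

(** If no side separates the two, the larger left end and the larger lower end give a common point.
    Fatness makes both rectangles nonempty, so that this point lies in each of them. *)
Lemma not_intersects_separated r q : fat r -> fat q ->
  ~ intersects r q -> separated r q.
Proof.
rewrite /fat /width /height => fr fq h; apply/negPn/negP => ns; apply: h.
exists (Num.max (xmin r) (xmin q), Num.max (ymin r) (ymin q)).
move: ns; rewrite /separated !negb_or -!leNgt => /and4P[h1 h2 h3 h4].
by split; split => /=; rewrite le_max ge_max lexx ?orbT /=; lra.
Qed.

Definition xoverlap r q := (xmin r <= xmax q) && (xmin q <= xmax r).

(* A vertical conflict: only the order of [r] and [q] along the y-axis
   separates them, and the gap is too small to be seen by the unit grid. *)
Definition vconflict r q :=
  [&& xoverlap r q, ymin q < ymax r + 1 & ymin r < ymax q + 1].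

Lemma vconflict_sym r q : vconflict r q = vconflict q r.
Proof. by rewrite /vconflict /xoverlap [_ && (xmin q <= _)]andbC [X in _ && X]andbC. Qed.

(** Both [q] and [q'] meet the vertical line through the left side of [r], and both start less than
    1 above [r]. Having height at least 1, they overlap vertically as well, so they cannot be
    separated. *)
Lemma above_unique r q q' : fat q -> fat q' ->
  (q != q' -> separated q q') ->
  xmin q <= xmin r -> xmin q' <= xmin r -> vconflict r q -> vconflict r q' ->
  ymax r < ymin q -> ymax r < ymin q' -> q = q'.
Proof.
rewrite /fat /width /height /vconflict /xoverlap => f f' sep l l' c c' a a'.
by apply/eqP/negPn/negP => /sep /or4P[] h; lra.
Qed.

Lemma below_unique r q q' : fat q -> fat q' ->
  (q != q' -> separated q q') ->
  xmin q <= xmin r -> xmin q' <= xmin r -> vconflict r q -> vconflict r q' ->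
  ymax q < ymin r -> ymax q' < ymin r -> q = q'.
Proof.
rewrite /fat /width /height /vconflict /xoverlap => f f' sep l l' c c' a a'.
by apply/eqP/negPn/negP => /sep /or4P[] h; lra.
Qed.

(* Scanned from left to right, a rectangle conflicts vertically with at most
   two earlier ones: its left side sees at most one just above and at most one
   just below. *)
Lemma three_coloring s : all fat s -> {in s &, forall r q, r != q -> separated r q} ->
  exists2 col : rect R -> nat, (forall r, col r < 3)%N &
    {in s &, forall r q, r != q -> vconflict r q -> col r != col q}.
Proof.
(* The list is sorted by decreasing left side: the induction colours the tail first, so that each
   new head starts no further left than any rectangle coloured before it. *)
pose ge r q := xmin q <= xmin r.
have ge_tot : total ge by move=> r q; exact: le_total.
have ge_tr : transitive ge by move=> r q p h1 h2; exact: le_trans h2 h1.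
suff main t : pairwise ge t -> all fat t ->
    {in t &, forall r q, r != q -> separated r q} ->
    exists2 col : rect R -> nat, (forall r, col r < 3)%N &
    {in t &, forall r q, r != q -> vconflict r q -> col r != col q}.
  move=> fs ds; have mem_s := mem_sort ge s.
  have [||r q|col lt h] := main (sort ge s).
  - by rewrite -sorted_pairwise // sort_sorted.
  - by rewrite (eq_all_r mem_s).
  - by rewrite !mem_s; exact: ds.
  - by exists col => // r q; rewrite -!mem_s; exact: h.
elim: t => [|r t IH] /=; first by exists (fun=> 0%N).
case/andP => ger pt /andP[fr ft] dt.
have [|col lt proper] := IH pt ft; first by move=> p q pi qi; apply: dt; rewrite inE ?pi ?qi orbT.
pose up q := vconflict r q && (ymax r < ymin q).
pose dn q := vconflict r q && (ymax q < ymin r).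
(* The colours of the unique conflicting rectangles above and below [r]. If one of them is missing,
   [nth] returns its default and an arbitrary colour is avoided, which does no harm. *)
pose a := col (nth r t (find up t)); pose b := col (nth r t (find dn t)).
have [c [c3 ca cb]] : exists c, [/\ (c < 3)%N, c != a & c != b].
  by case: (a) (b) => [|[|a']] [|[|b']];
    [exists 1%N|exists 2|exists 1%N|exists 2|exists 0%N|exists 0%N
    |exists 1%N|exists 0%N|exists 0%N].
have key q : q \in t -> q != r -> vconflict r q -> c != col q.
  move=> qt qr cf.
  have ud : up q || dn q.
    have := dt r q; rewrite !inE eqxx qt orbT => /(_ isT isT).
    rewrite eq_sym => /(_ qr); rewrite /up /dn cf /=.
    move: cf; rewrite /vconflict /xoverlap => /andP[/andP[h1 h2] _].
    by case/or4P => [h|h|->|->]; rewrite ?orbT //; exfalso; lra.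
  have sep q' : q' \in t -> q != q' -> separated q q'.
    by move=> q't; apply: dt; rewrite inE ?qt ?q't orbT.
  have ge_r q' : q' \in t -> xmin q' <= xmin r by move/(allP ger).
  have ft' q' : q' \in t -> fat q' by move/(allP ft).
  case/orP: ud => hq.
    have hu : has up t by apply/hasP; exists q.
    have mt : nth r t (find up t) \in t by rewrite mem_nth // -has_find.
    have /andP[c1 c2] := nth_find r hu; case/andP: (hq) => d1 d2.
    rewrite (@above_unique r q (nth r t (find up t))) //; try exact: ft'.
    + exact: sep.
    + exact: ge_r.
    + exact: ge_r.
  have hu : has dn t by apply/hasP; exists q.
  have mt : nth r t (find dn t) \in t by rewrite mem_nth // -has_find.
  have /andP[c1 c2] := nth_find r hu; case/andP: (hq) => d1 d2.
  rewrite (@below_unique r q (nth r t (find dn t))) //; try exact: ft'.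
  + exact: sep.
  + exact: ge_r.
  + exact: ge_r.
exists (fun q => if q == r then c else col q) => [q|p q]; first by case: ifP.
rewrite !inE; case: (eqVneq p r) => [->|pr]; case: (eqVneq q r) => [->|qr] //=.
- by move=> _ qt _; exact: key.
- by move=> pt' _ _; rewrite vconflict_sym eq_sym; exact: key.
- exact: proper.
Qed.

(** Members of negative weight are dropped from the colour classes, which can only increase the
    sums; one of the three classes then carries at least a third of the total. *)
Lemma heavy_conflict_free s w : uniq s -> all fat s ->
  {in s &, forall r q, r != q -> separated r q} ->
  exists2 X, [/\ subseq X s, {in X, forall r, 0 <= w r} &
                 {in X &, forall r q, r != q -> ~~ vconflict r q}] &
    \sum_(r <- s) w r <= 3 * \sum_(r <- X) w r.
Proof.
move=> us fs ds; have [col lt proper] := three_coloring fs ds.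
pose X c := [seq r <- s | (0 <= w r) && (col r == c)].
have sX c : subseq (X c) s by exact: filter_subseq.
have le_sum : \sum_(r <- s) w r <=
    \sum_(r <- X 0%N) w r + \sum_(r <- X 1%N) w r + \sum_(r <- X 2%N) w r.
  rewrite !big_filter [leRHS]addrC !(big_mkcond (fun r => _ && _)) -!big_split /=.
  apply: ler_sum => r _; have := lt r.
  by case: (lerP 0 (w r)) => h; case: (col r) => [|[|[|k]]] //= _; lra.
have ok c : [/\ subseq (X c) s, {in X c, forall r, 0 <= w r} &
                 {in X c &, forall r q, r != q -> ~~ vconflict r q}].
  split=> // [r|r q]; rewrite !mem_filter; first by case/andP => /andP[].
  case/andP=> /andP[_ /eqP cr] rs /andP[/andP[_ /eqP cq] qs] rq.
  by apply/negP => /(proper _ _ rs qs rq); rewrite cr cq eqxx.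
have [h0|h0] := lerP (\sum_(r <- s) w r) (3 * \sum_(r <- X 0%N) w r).
  by exists (X 0%N).
have [h1|h1] := lerP (\sum_(r <- s) w r) (3 * \sum_(r <- X 1%N) w r).
  by exists (X 1%N).
by exists (X 2) => //; lra.
Qed.

(* Each rectangle contains the grid point below and to the left of its upper
   right corner. *)
Lemma packing_bound (A : nat) (x0 y0 : R) s : uniq s -> all fat s ->
  {in s &, forall r q, r != q -> separated r q} ->
  {in s, forall r, 0 <= xmax r - x0 < A%:R /\ 0 <= ymax r - y0 < A%:R} ->
  (size s <= A * A)%N.
Proof.
move=> us fs ds bs.
pose f r := (Num.truncn (xmax r - x0), Num.truncn (ymax r - y0)).
have inj : {in s &, injective f}.
  move=> r q rs qs [ex ey]; apply/eqP/negPn/negP => /(ds _ _ rs qs).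
  have [/andP[x1 _] /andP[y1 _]] := bs r rs.
  have [/andP[x2 _] /andP[y2 _]] := bs q qs.
  have /andP[a1 a2] := truncn_itv x1; have /andP[a3 a4] := truncn_itv y1.
  have /andP[b1 b2] := truncn_itv x2; have /andP[b3 b4] := truncn_itv y2.
  (* With equal grid points the upper right corners differ by less than 1 in each coordinate, too
     little for one rectangle to lie beyond the other. *)
  move: a1 a2 a3 a4; rewrite ex ey -!natr1 => a1 a2 a3 a4.
  move: b2 b4; rewrite -!natr1 => b2 b4.
  move: (allP fs r rs) (allP fs q qs); rewrite /fat /width /height {ex ey}.
  by move=> fr fq /or4P[] h; lra.
rewrite -(size_map f) -[X in (_ <= X * X)%N](size_iota 0 A) -(size_allpairs pair).
apply: uniq_leq_size; first by rewrite map_inj_in_uniq.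
move=> _ /mapP[r /bs[/andP[x1 x2] /andP[y1 y2]] ->].
by apply/allpairsP; exists (f r); rewrite /= !mem_iota /= !truncn_lt_nat.
Qed.

Lemma dist_ge_x (p q : R * R) : `|p.1 - q.1| <= dist p q.
Proof. by rewrite -sqrtr_sqr ler_wsqrtr // lerDl sqr_ge0. Qed.

Lemma dist_ge_y (p q : R * R) : `|p.2 - q.2| <= dist p q.
Proof. by rewrite -sqrtr_sqr ler_wsqrtr // lerDr sqr_ge0. Qed.

Lemma dist_le_diam (S : {fset rect R}) r q p p' : r \in S -> q \in S ->
  p \in corners r -> p' \in corners q -> dist p p' <= diam S.
Proof.
move=> rS qS pr pq; rewrite /diam.
have mv r' v : r' \in S -> v \in corners r' ->
    v \in flatten [seq corners r | r <- S].
  by move=> r'S vr; apply/flattenP; exists (corners r') => //; exact: map_f.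
apply: (@bigmax_sup_seq _ _ _ _ _ p); [exact: mv rS pr|by []|].
by apply: (@bigmax_sup_seq _ _ _ _ _ p'); [exact: mv qS pq| |].
Qed.

Lemma diam_bounds (S : {fset rect R}) r q : r \in S -> q \in S ->
  `|xmax r - xmin q| <= diam S /\ `|ymax r - ymin q| <= diam S.
Proof.
move=> rS qS.
have h : dist (xmax r, ymax r) (xmin q, ymin q) <= diam S.
  by apply: dist_le_diam rS qS _ _; rewrite !inE eqxx ?orbT.
by split; [have := dist_ge_x (xmax r, ymax r) (xmin q, ymin q)
          |have := dist_ge_y (xmax r, ymax r) (xmin q, ymin q)];
  move/le_trans; apply.
Qed.

End Geometry.

(** * Greedy completion of a guess *)

(* Registers. Integers: 0 number of rectangles, 1 loop counter, 2 the constant 1,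
   3 base address of the data, 4 data pointer, 5 size of the best solution,
   10 + 2k (resp. 11 + 2k) index of member k of the current (resp. best) solution.
   Reals: 1-5 fields of the rectangle at hand, 6 base line, 7 delta, 8 best
   weight, 9 current weight, 10 whether a candidate was found, 11 its weight,
   12-14 bounds asked for by the entry, 15 and 16 the constants 0 and 1, 17 the
   maximum weight, 20 + k right side of member k of the current solution. *)
Definition code (l : seq instr) : stmt := foldr (fun i => Seq (Atom i)) Skip l.

Definition guards (gs : seq (bool * nat * nat)) (s : stmt) : stmt :=
  foldr (fun g => Guard g.1.1 g.1.2 g.2) s gs.

Definition address (d b : nat) : stmt :=
  code [:: IMove d b; IAdd d d 1; IAdd d d 1; IAdd d d 1; IAdd d d 1; IAdd d d 1].

Definition fetch (r : nat) : stmt := code [:: RLoad r 4; IAdd 4 4 2].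

Definition load : stmt :=
  Seq (address 4 3) (Seq (fetch 1) (Seq (fetch 2) (Seq (fetch 3)
    (Seq (fetch 4) (fetch 5))))).

(* The entry ((p, q), l) asks for a rectangle whose y-range lies in [p, q), relative
   to a base line, and whose weight is at least l * delta. *)
Definition entry : Type := (nat * nat * nat)%type.
Definition entry0 : entry := (0, 0, 0)%N.

(* The grid does not separate the y-ranges allowed by [e] and [e']. *)
Definition tight (e e' : entry) : bool :=
  (e.1.1 < e'.1.2)%N && (e'.1.1 < e.1.2)%N.

Definition record (k : nat) : stmt :=
  code [:: RMove (20 + k) 2; RMove 11 5; IMove (10 + 2 * k) 1; RConst 10 1].

(** [tight] is evaluated when the program text is generated. At run time each tight predecessor
    costs one comparison of its right side with the left side at hand, the others none. *)
Definition candidate_tests (prev : seq entry) (e : entry) : seq (bool * nat * nat) :=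
  [:: (false, 3, 12); (true, 4, 13); (false, 5, 14)]%N ++
  [seq (true, 20 + j, 1)%N | j <- iota 0 (size prev) & tight (nth entry0 prev j) e].

(** The first guard takes the first candidate, the second a strict improvement. When the first has
    just fired, the second compares a number with itself and does nothing. *)
Definition scan_body (prev : seq entry) (e : entry) : stmt :=
  let k := size prev in
  Seq load (guards (candidate_tests prev e)
    (Seq (Guard true 10 16 (record k)) (Guard true 2 (20 + k) (record k)))).

Definition select (prev : seq entry) (e : entry) : stmt :=
  Seq (code [:: RConst 10 0; RConst 12 e.1.1; RAdd 12 12 6; RConst 13 e.1.2;
                RAdd 13 13 6; RConst 14 e.2; RMul 14 14 7])
      (For (scan_body prev e)).

Definition accept (k : nat) : stmt :=
  Guard true 8 9 (Seq (code [:: RMove 8 9; IConst 5 k])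
    (code [seq IMove (11 + 2 * j) (10 + 2 * j) | j <- iota 0 k])).

(** The continuation sits inside the test that a candidate was found, so an entry without candidates
    abandons the whole guess. *)
Fixpoint members (prev g : seq entry) : stmt :=
  match g with
  | [::] => accept (size prev)
  | e :: g' => Seq (select prev e)
      (Guard true 15 10 (Seq (Atom (RAdd 9 9 11)) (members (rcons prev e) g')))
  end.

Definition attempt (g : seq entry) : stmt :=
  Seq (Atom (RConst 9 0)) (members [::] g).

Definition attempts (gs : seq (seq entry)) : stmt := foldr (fun g => Seq (attempt g)) Skip gs.

Lemma all_atoms_code p l : all_atoms p (code l) = all p l.
Proof. by elim: l => //= i l ->. Qed.

Lemma all_atoms_guards p gs s : all_atoms p (guards gs s) = all_atoms p s.
Proof. by elim: gs. Qed.

Lemma swrites_guards wr lw gs s : swrites wr lw (guards gs s) = swrites wr lw s.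
Proof. by elim: gs. Qed.

Lemma loop_free_guards gs s : loop_free (guards gs s) = loop_free s.
Proof. by elim: gs. Qed.

Lemma loop_free_code l : loop_free (code l).
Proof. by elim: l. Qed.

Lemma swrites_code wr lw l : swrites wr lw (code l) = flatten (map wr l).
Proof. by elim: l => //= i l ->. Qed.

Lemma scan_body_atoms prev e :
  all_atoms atomic (scan_body prev e) && all_atoms no_rstore (scan_body prev e).
Proof. by rewrite /scan_body /= !all_atoms_guards. Qed.

Lemma real_writes_scan_body prev e : real_writes (scan_body prev e) =
  [:: 1; 2; 3; 4; 5; 20 + size prev; 11; 10; 20 + size prev; 11; 10]%N.
Proof. by rewrite /real_writes /scan_body /= swrites_guards. Qed.

Lemma nat_writes_scan_body prev e : {subset nat_writes (scan_body prev e) <=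
  [:: 4; 10 + 2 * size prev]%N}.
Proof.
move=> r; rewrite /nat_writes /scan_body /= swrites_guards /=.
by rewrite !inE; do !case: (_ == _).
Qed.

Section Fragments.
Variable R : realType.
Implicit Types (m : memory R).

Lemma den_Seq s1 s2 m : den (Seq s1 s2) m = den s2 (den s1 m).
Proof. by []. Qed.

Lemma den_Guard v i j s m :
  den (Guard v i j s) m = if (m.2 i < m.2 j) == v then den s m else m.
Proof. by []. Qed.

Lemma den_guards gs s m : den (guards gs s) m =
  if all (fun g => (m.2 g.1.2 < m.2 g.2) == g.1.1) gs then den s m else m.
Proof. by elim: gs => //= g gs ->; case: ifP. Qed.

Lemma den_address d b m : d != 1%N ->
  (den (address d b) m).1 d = (m.1 b + 5 * m.1 1)%N.
Proof.
move=> /negPf d1; rewrite /address /= /den_instr /=.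
by rewrite !updE eqxx [(1 == d)%N]eq_sym d1; lia.
Qed.

Lemma den_fetch r m : den (fetch r) m =
  (upd m.1 4 (m.1 4 + m.1 2)%N, upd m.2 r (m.2 (m.1 4%N))).
Proof. by []. Qed.

Lemma fetch_step r a m : m.1 4%N = a -> m.1 2%N = 1%N ->
  [/\ (den (fetch r) m).1 4%N = a.+1, (den (fetch r) m).1 2%N = 1%N,
      (den (fetch r) m).2 r = m.2 a &
      forall r', r' != r -> (den (fetch r) m).2 r' = m.2 r'].
Proof.
move=> h4 h2; rewrite den_fetch /= !updE h4 h2 addn1 !eqxx.
by split=> // r' /negPf h; rewrite updE h.
Qed.

Lemma den_record k m : den (record k) m =
  (upd m.1 (10 + 2 * k)%N (m.1 1%N),
   upd (upd (upd m.2 (20 + k)%N (m.2 2%N)) 11 (m.2 5%N)) 10 1).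
Proof. by []. Qed.

(** A source may be overwritten once it has been read: only an earlier destination must differ from
    a later source. The epilogue relies on this, as its destinations [i.+1] can meet its sources
    [11 + 2 * j]. *)
Lemma den_copy (d s : nat -> nat) a k m :
  (forall i j, (a <= i)%N -> (i < j)%N -> d i != s j) -> injective d ->
  let m' := den (code [seq IMove (d j) (s j) | j <- iota a k]) m in
  m'.2 = m.2 /\ forall j, (a <= j < a + k)%N -> m'.1 (d j) = m.1 (s j).
Proof.
elim: k a m => [|k IH] a m ds dinj /=.
  by split=> // j; rewrite addn0 => /andP[/leq_ltn_trans h /h]; rewrite ltnn.
have [|e2 e1] := IH a.+1 (den_instr (IMove (d a) (s a)) m) _ dinj.
  by move=> i j ai; apply: ds; exact: ltnW.
split; first by rewrite e2.
move=> j /andP[]; rewrite leq_eqVlt => /orP[/eqP <- _|aj lt].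
  rewrite den_nat ?all_atoms_code ?all_map; last 2 first.
  - exact/allP.
  - rewrite /nat_writes swrites_code -map_comp; apply/flattenP => -[_ /mapP[i + ->]].
    by rewrite mem_iota inE => /andP[ai _] /eqP /dinj e; rewrite e ltnn in ai.
  by rewrite /den_instr /= updE eqxx.
rewrite e1 ?aj ?addSnnS //= /den_instr /= updE eq_sym.
by rewrite (negPf (ds _ _ (leqnn a) aj)).
Qed.

Lemma separated_fat (r : rect R) : fat r -> ~~ separated r r.
Proof. by rewrite /fat /width /height => f; apply/negP => /or4P[] h; lra. Qed.

End Fragments.

(** * Correctness of the greedy selection on the machine *)

Section Analysis.
Variables (R : realType) (n B K : nat) (rr : nat -> rect R) (ww : nat -> R).
Hypothesis B_ge : (20 + K <= B)%N.
Hypothesis rr_fat : forall i, (i < n)%N -> fat (rr i).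
Implicit Types (m : memory R).

Definition stored_at (X : nat -> R) (a : nat) (r : rect R) (v : R) : Prop :=
  [/\ X a = xmin r, X (a + 1)%N = xmax r, X (a + 2)%N = ymin r,
      X (a + 3)%N = ymax r & X (a + 4)%N = v].

Definition data m : Prop :=
  [/\ m.1 0%N = n, m.1 3%N = B &
      forall i, (i < n)%N -> stored_at m.2 (B + 5 * i) (rr i) (ww i)].

Lemma den_load m i : data m -> m.1 1%N = i -> m.1 2%N = 1%N -> (i < n)%N ->
  [/\ (den load m).2 1%N = xmin (rr i), (den load m).2 2%N = xmax (rr i),
      (den load m).2 3%N = ymin (rr i), (den load m).2 4%N = ymax (rr i) &
      (den load m).2 5%N = ww i].
Proof.
move=> [h0 h3 hd] h1 h2 lt; have := hd i lt.
rewrite /load (den_Seq (address 4 3)) (den_Seq (fetch 1)) (den_Seq (fetch 2)).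
rewrite (den_Seq (fetch 3)) (den_Seq (fetch 4)).
set m0 := den (address 4 3) m.
have a4 : m0.1 4%N = (B + 5 * i)%N by rewrite den_address // h3 h1.
have a2 : m0.1 2%N = 1%N by rewrite den_nat.
have ar r : m0.2 r = m.2 r by rewrite den_real.
(* The data begin at cell 20 or later, so filling registers 1 to 5 leaves the cells still to be read
   intact. *)
have : (20 <= B + 5 * i)%N by lia.
move: (B + 5 * i)%N a4 => a a4 ge; rewrite /stored_at => -[<- <- <- <- <-].
have [b4 b2 b1 br] := fetch_step 1 a4 a2; set m1 := den _ m0 in b4 b2 b1 br *.
have [c4 c2 c1 cr] := fetch_step 2 b4 b2; set m2 := den _ m1 in c4 c2 c1 cr *.
have [d4 d2 d1 dr] := fetch_step 3 c4 c2; set m3 := den _ m2 in d4 d2 d1 dr *.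
have [e4 e2 e1 er] := fetch_step 4 d4 d2; set m4 := den _ m3 in e4 e2 e1 er *.
have [f4 f2 f1 fr] := fetch_step 5 e4 e2; set m5 := den _ m4 in f4 f2 f1 fr *.
split.
- by rewrite fr // er // dr // cr // b1 ar.
- by rewrite fr // er // dr // c1 br ?ar ?addn1 //; lia.
- by rewrite fr // er // d1 cr ?br ?ar ?addn2 //; lia.
- by rewrite fr // e1 dr ?cr ?br ?ar ?addn3 //; lia.
- by rewrite f1 er ?dr ?cr ?br ?ar ?addn4 //; lia.
Qed.

Variables (y0 delta : R).

Definition consts m : Prop :=
  [/\ m.2 6%N = y0, m.2 7%N = delta, m.2 15%N = 0 & m.2 16%N = 1].

Definition box (e : entry) (i : nat) : bool :=
  [&& e.1.1%:R + y0 <= ymin (rr i), ymax (rr i) < e.1.2%:R + y0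
    & e.2%:R * delta <= ww i].

Definition eligible (prev : seq entry) (c : seq nat) (e : entry) (i : nat) : bool :=
  box e i && all (fun j => tight (nth entry0 prev j) e ==>
    (xmax (rr (nth 0%N c j)) < xmin (rr i))) (iota 0 (size prev)).

Definition chosen (prev : seq entry) (c : seq nat) m : Prop :=
  forall j, (j < size prev)%N -> m.2 (20 + j)%N = xmax (rr (nth 0%N c j)) /\
    m.1 (10 + 2 * j)%N = nth 0%N c j.

Definition leftmost (P : pred nat) (k t : nat) m : Prop :=
  (m.2 10%N = 0 /\ forall i, (i < t)%N -> ~~ P i) \/
  (m.2 10%N = 1 /\ exists i, [/\ (i < t)%N, P i, m.1 (10 + 2 * k)%N = i,
      m.2 (20 + k)%N = xmax (rr i) & m.2 11%N = ww i] /\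
      (forall i', (i' < t)%N -> P i' -> xmax (rr i) <= xmax (rr i'))).

Lemma leftmostS (P : pred nat) k t m m' : leftmost P k t m ->
  [/\ m'.1 (10 + 2 * k)%N = m.1 (10 + 2 * k)%N, m'.2 10%N = m.2 10%N,
      m'.2 11%N = m.2 11%N & m'.2 (20 + k)%N = m.2 (20 + k)%N] ->
  [/\ m'.1 1%N = t, m'.2 16%N = 1, m'.2 2%N = xmax (rr t) & m'.2 5%N = ww t] ->
  leftmost P k t.+1 (if P t then
    den (Seq (Guard true 10 16 (record k)) (Guard true 2 (20 + k) (record k))) m'
    else m').
Proof.
move=> lm [e1 e2 e3 e4] [f1 f2 f3 f4]; case: ifP => Pt; last first.
  case: lm => [[h0 no]|[h1 [i [[lt Pi g1 g2 g3] mn]]]].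
    left; split; first by rewrite e2.
    by move=> i; rewrite ltnS leq_eqVlt => /orP[/eqP->|/no]; rewrite ?Pt.
  right; split; first by rewrite e2.
  exists i; rewrite e1 e3 e4; split; [by split=> //; exact: ltnW|move=> i'].
  by rewrite ltnS leq_eqVlt => /orP[/eqP->|/mn//]; rewrite Pt.
rewrite den_Seq !den_Guard !den_record f2 e2.
case: lm => [[h0 no]|[h1 [i [[lt Pi g1 g2 g3] mn]]]].
  rewrite h0 ltr01 eqxx /= /upd /= eqxx ltxx /=.
  right; split=> //; exists t; rewrite /= !eqxx; split=> //.
  move=> i'; rewrite ltnS leq_eqVlt => /orP[/eqP-> //|/no/negPf->//].
rewrite h1 ltxx /= f3 e4 g2; case: ltP => cmp; rewrite /=; right.
  split=> //; exists t; rewrite /= /upd !eqxx /=; split=> //.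
  move=> i'; rewrite ltnS leq_eqVlt => /orP[/eqP-> //|lt' Pi'].
  exact: le_trans (ltW cmp) (mn _ lt' Pi').
split; first by rewrite e2.
exists i; rewrite e1 e3 e4; split; [by split=> //; exact: ltnW|move=> i'].
by rewrite ltnS leq_eqVlt => /orP[/eqP->//|/mn].
Qed.

Lemma select_spec prev c e m : data m -> consts m -> (size prev < K)%N ->
  chosen prev c m ->
  leftmost (eligible prev c e) (size prev) n (den (select prev e) m).
Proof.
move=> dm [c6 c7 c15 c16] lt ch.
set k := size prev.
rewrite /select den_Seq.
set m0 := den (code _) m.
have m0_10 : m0.2 10%N = 0 by [].
have m0_12 : m0.2 12%N = e.1.1%:R + y0 by rewrite -c6.
have m0_13 : m0.2 13%N = e.1.2%:R + y0 by rewrite -c6.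
have m0_14 : m0.2 14%N = e.2%:R * delta by rewrite -c7.
have m0_16 : m0.2 16%N = 1 by rewrite -c16.
have m0n r : m0.1 r = m.1 r by [].
have fr0 r : (20 <= r)%N -> m0.2 r = m.2 r.
  move=> r20; apply: den_real => //.
  rewrite /real_writes /= !inE; lia.
have n0 : m0.1 0%N = n by rewrite m0n; case: dm.
move: m0 m0_10 m0_12 m0_13 m0_14 m0_16 m0n fr0 n0 => m0 m0_10 m0_12 m0_13 m0_14 m0_16 m0n fr0 n0.
(* Outside the scratch registers and the slot [k] being filled nothing changes, so the data and the
   earlier choices, on which eligibility depends, are the same throughout the scan. *)
pose frame (mm : memory R) :=
  (forall r, r \notin [:: 1; 2; 3; 4; 5; 20 + k; 11; 10]%N -> mm.2 r = m0.2 r) /\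
  (forall r, r \notin [:: 1; 2; 4; 10 + 2 * k]%N -> mm.1 r = m.1 r).
rewrite -n0.
pose I t mm := [/\ frame mm, mm.1 1%N = t, mm.1 2%N = 1%N &
                   leftmost (eligible prev c e) k t mm].
suff [] : I (m0.1 0%N) (den (For (scan_body prev e)) m0) by [].
apply: for_ind.
  split=> //; last by left.
  by split=> // r; rewrite !inE !negb_or /upd /= => /and4P[/negPf-> /negPf-> _ _]; rewrite m0n.
move=> t mm; rewrite n0 => ltn [[fr fn] ct on lm].
have dmm : data mm.
  case: dm => d0 d3 dd; split; [by rewrite fn|by rewrite fn|].
  move=> i /dd; rewrite /stored_at => -[s1 s2 s3 s4 s5].
  by split; rewrite fr ?fr0 // ?inE; lia.
have [l1 l2 l3 l4 l5] := den_load dmm ct on ltn.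
have /andP[at1 at2] := scan_body_atoms prev e.
have lr : forall r, r \notin [:: 1; 2; 3; 4; 5]%N -> (den load mm).2 r = mm.2 r.
  by move=> r hr; apply: den_real.
have ln : forall r, r != 4%N -> (den load mm).1 r = mm.1 r.
  by move=> r r4; apply: den_nat => //; rewrite /nat_writes /= !inE !negb_or r4.
have [m2 m2E] : {m2 | m2 = den load mm} by exists (den load mm).
rewrite -!m2E in l1 l2 l3 l4 l5 lr ln.
have body : den (scan_body prev e) mm = if eligible prev c e t then
    den (Seq (Guard true 10 16 (record k)) (Guard true 2 (20 + k) (record k))) m2
    else m2.
  rewrite /scan_body den_Seq -m2E den_guards; congr (if _ then _ else _).
  rewrite /candidate_tests /= all_map all_filter /eligible /box.
  rewrite l3 l4 l5 (lr 12%N) // (lr 13%N) // (lr 14%N) // !fr //.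
  rewrite m0_12 m0_13 m0_14 !eqbF_neg -!leNgt eqb_id -!andbA.
  do 3 congr (_ && _).
  apply: eq_in_all => j; rewrite mem_iota /= add0n => ltj.
  rewrite l1 lr ?fr ?fr0; [|by []|by rewrite !inE /k; lia|by rewrite !inE; lia].
  by have [-> _] := ch j ltj; rewrite eqb_id.
have body_nat r : r \notin [:: 4; 10 + 2 * k]%N -> (den (scan_body prev e) mm).1 r = mm.1 r.
  by move=> hr; apply: den_nat => //; apply: contra hr; exact: nat_writes_scan_body.
have body_real r : r \notin [:: 1; 2; 3; 4; 5; 20 + k; 11; 10]%N ->
    (den (scan_body prev e) mm).2 r = mm.2 r.
  move=> hr; apply: den_real => //; rewrite real_writes_scan_body.
  by move: hr; rewrite !inE -/k; lia.
move: (den (scan_body prev e) mm) body body_nat body_real => mm' body body_nat body_real.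
split.
- split=> r hr; rewrite /set_ctr /= ?updE.
    by rewrite body_real // fr.
  move: (hr); rewrite !inE !negb_or => /and4P[r1 r2 r4 rk].
  by rewrite (negPf r1) body_nat ?fn // ?inE ?negb_or ?r4 ?rk.
- by [].
- by rewrite /set_ctr /= updE /= body_nat.
- suff : leftmost (eligible prev c e) k t.+1 mm'.
    by case=> [?|[? [i ?]]]; [left|right; split=> //; exists i].
  rewrite body; apply: leftmostS lm _ _.
    split; [exact: ln|exact: lr|exact: lr|apply: lr; rewrite !inE; lia].
  split=> //; [by rewrite ln|].
  by rewrite lr // fr.
Qed.

Definition valid (t : seq nat) : Prop :=
  [/\ uniq t, {in t, forall i, (i < n)%N} &
      {in t &, forall i j, i != j -> separated (rr i) (rr j)}].

(** Horizontal order is imposed on tight pairs only, since the boxes alone separate all others. *)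
Definition selection (g : seq entry) (c : seq nat) : Prop :=
  [/\ size c = size g,
      forall j, (j < size g)%N -> (nth 0 c j < n)%N /\ box (nth entry0 g j) (nth 0%N c j) &
      forall i j, (i < j < size g)%N -> tight (nth entry0 g i) (nth entry0 g j) ->
        xmax (rr (nth 0%N c i)) < xmin (rr (nth 0%N c j))].

Definition value (g : seq entry) : R := \sum_(e <- g) e.2%:R * delta.

Definition profit (c : seq nat) : R := \sum_(i <- c) ww i.

(** A tight pair is separated horizontally by definition. Otherwise one y-interval ends at or below
    the start of the other and, the intervals being half-open, the closed rectangles do not even
    touch. *)
Lemma selection_separated g c i j : selection g c -> (i < j < size g)%N ->
  separated (rr (nth 0%N c i)) (rr (nth 0%N c j)).
Proof.
move=> [sz bx tg] lt; have [ni /and3P[i1 i2 _]] := bx i (ltn_trans (andP lt).1 (andP lt).2).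
have [nj /and3P[j1 j2 _]] := bx j (andP lt).2.
rewrite /separated; have [/(tg i j lt) -> //|] := boolP (tight (nth entry0 g i) (nth entry0 g j)).
rewrite /tight negb_and -!leqNgt => /orP[] le.
- have : (nth entry0 g j).1.2%:R <= (nth entry0 g i).1.1%:R :> R by rewrite ler_nat.
  by move=> le'; apply/or4P; constructor 4; lra.
- have : (nth entry0 g i).1.2%:R <= (nth entry0 g j).1.1%:R :> R by rewrite ler_nat.
  by move=> le'; apply/or4P; constructor 3; lra.
Qed.

Lemma selection_valid g c : selection g c -> valid c.
Proof.
move=> sel; have [sz bx _] := sel.
have sep i j : (i < size c)%N -> (j < size c)%N -> i != j ->
    separated (rr (nth 0%N c i)) (rr (nth 0%N c j)).
  rewrite sz => li lj; case: ltngtP => // lt _.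
    by apply: (selection_separated sel); rewrite lt.
  by rewrite separated_sym; apply: (selection_separated sel); rewrite lt.
split.
- apply/(uniqP 0%N) => i j li lj e; apply/eqP/negPn/negP => ne.
  have := sep i j li lj ne; rewrite e; apply/negP; apply: separated_fat.
  by apply: rr_fat; apply: (bx j _).1; rewrite -sz.
- by move=> _ /(nthP 0%N)[i li <-]; apply: (bx i _).1; rewrite -sz.
- move=> _ _ /(nthP 0%N)[i li <-] /(nthP 0%N)[j lj <-] ne.
  by apply: sep => //; apply: contra ne => /eqP->.
Qed.

Lemma selection_value g c : selection g c -> value g <= profit c.
Proof.
move=> [sz bx _]; rewrite /value /profit (big_nth entry0) [leRHS](big_nth 0%N) sz.
rewrite !big_mkord; apply: ler_sum => i _.
by have [_ /and3P[]] := bx i (ltn_ord i).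
Qed.

Lemma selection_rcons prev c e i : selection prev c -> (i < n)%N ->
  eligible prev c e i -> selection (rcons prev e) (rcons c i).
Proof.
move=> [sz bx tg] ltn /andP[bi al]; split; first by rewrite !size_rcons sz.
- move=> j; rewrite size_rcons ltnS leq_eqVlt => /orP[/eqP->|lt].
    by rewrite !nth_rcons sz ltnn eqxx.
  by rewrite !nth_rcons sz lt; exact: bx.
- move=> a b; rewrite size_rcons ltnS => /andP[ab]; rewrite leq_eqVlt => /orP[/eqP eb|lt].
    rewrite !nth_rcons sz -eb ab ltnn eqxx => t; rewrite eb in ab.
    by have := allP al a; rewrite mem_iota ab => /(_ isT); rewrite t.
  have la := ltn_trans ab lt; rewrite !nth_rcons sz la lt.
  by apply: tg; rewrite ab.
Qed.

(* The invariant of the greedy selection: [c] is never to the right of [x]. *)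
Lemma eligible_dominated prev e g c x : size c = size prev ->
  selection (prev ++ e :: g) x ->
  (forall j, (j < size prev)%N ->
     xmax (rr (nth 0%N c j)) <= xmax (rr (nth 0%N x j))) ->
  eligible prev c e (nth 0%N x (size prev)).
Proof.
move=> sz [szx bx tg] dom; have lt : (size prev < size (prev ++ e :: g))%N.
  by rewrite size_cat /= addnS ltnS leq_addr.
have [_] := bx _ lt; rewrite nth_cat ltnn subnn /= /eligible => -> /=.
apply/allP => j; rewrite mem_iota /= add0n => ltj; apply/implyP => t.
apply: le_lt_trans (dom j ltj) _; apply: tg; first by rewrite ltj lt.
by rewrite !nth_cat ltj ltnn subnn.
Qed.

Definition best m : Prop := exists2 t : seq nat, valid t /\ (size t <= K)%N &
  [/\ m.1 5%N = size t, m.2 8%N = profit t &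
      forall j, (j < size t)%N -> m.1 (11 + 2 * j)%N = nth 0%N t j].

Definition ready m : Prop := [/\ data m, consts m & best m].

Lemma accept_spec prev c m : ready m -> selection prev c -> (size prev <= K)%N ->
  chosen prev c m -> m.2 9%N = profit c ->
  [/\ ready (den (accept (size prev)) m), m.2 8%N <= (den (accept (size prev)) m).2 8%N
    & value prev <= (den (accept (size prev)) m).2 8%N].
Proof.
move=> [dm cm bm] sel leK ch e9; rewrite /accept den_Guard.
have [sz _ _] := sel.
case: ltP => /= cmp; last by split=> //; apply: le_trans (selection_value sel) _; rewrite -e9.
set k := size prev.
set m1 := den_instr _ (den_instr _ m).
have [||e2 e1] := @den_copy R (fun j => 11 + 2 * j)%N (fun j => 10 + 2 * j)%N 0 k m1.
- by move=> i j _ _; lia.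
- by move=> i j; lia.
set m' := den _ m1 in e2 e1 *.
have fn r : (r < 11)%N -> m'.1 r = m1.1 r.
  move=> r11; apply: den_nat; first by rewrite all_atoms_code all_map; exact/allP.
  rewrite /nat_writes swrites_code -map_comp; apply/flattenP => -[_ /mapP[i _ ->]].
  by rewrite inE => /eqP; lia.
have m'8 : m'.2 8%N = m.2 9%N by rewrite e2.
have m'r r : r != 8%N -> m'.2 r = m.2 r.
  by move=> /negPf h; rewrite e2 /m1 /den_instr /= updE h.
split; [split| |].
- case: dm => d0 d3 dd; split; [by rewrite fn|by rewrite fn|].
  move=> i /dd; rewrite /stored_at => -[s1 s2 s3 s4 s5].
  by split; rewrite m'r //; lia.
- by case: cm => *; split; rewrite m'r.
- exists c; first by split; [exact: selection_valid sel|rewrite sz].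
  split; [by rewrite fn // sz|by rewrite m'8|].
  move=> j; rewrite sz => lt; rewrite e1 ?add0n //.
  by rewrite /m1 /den_instr /= updE; have [_ <-] := ch j lt.
- by rewrite m'8; exact: ltW.
- by rewrite m'8 e9; exact: selection_value sel.
Qed.

Lemma select_frame prev e m :
  (forall r, r \notin [:: 1; 2; 3; 4; 5; 10; 11; 12; 13; 14; 20 + size prev]%N ->
     (den (select prev e) m).2 r = m.2 r) /\
  (forall r, r \notin [:: 1; 2; 4; 10 + 2 * size prev]%N ->
     (den (select prev e) m).1 r = m.1 r).
Proof.
have /andP[at1 at2] := scan_body_atoms prev e.
split=> r hr.
- apply: den_real; [exact: at1|exact: at2|].
  rewrite -[real_writes _]/([:: 10; 12; 12; 13; 13; 14; 14]%N ++ real_writes (scan_body prev e)).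
  by rewrite real_writes_scan_body; move: hr; rewrite !inE; lia.
- apply: den_nat; first exact: at1.
  rewrite -[nat_writes _]/([:: 1; 2]%N ++ nat_writes (scan_body prev e)).
  apply/negP; rewrite mem_cat => /orP[|/nat_writes_scan_body];
  by move: hr; rewrite !inE; lia.
Qed.

(** The best solution occupies odd integer cells above 10 and the current one even cells, so the
    frame condition can be stated by parity, without mentioning the size of either. *)
Lemma ready_frame (m m' : memory R) : ready m ->
  (forall r, (r \in [:: 6; 7; 8; 15; 16]%N) || (B <= r)%N -> m'.2 r = m.2 r) ->
  (forall r, (r \in [:: 0; 3; 5]%N) || (10 < r)%N && odd r -> m'.1 r = m.1 r) ->
  ready m'.
Proof.
move=> [[d0 d3 dd] [c6 c7 c15 c16] [t tv [b5 b8 bt]]] fr fn; split.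
- split; [by rewrite fn|by rewrite fn|].
  move=> i /dd; rewrite /stored_at => -[s1 s2 s3 s4 s5].
  by split; rewrite fr ?inE //; lia.
- by split; rewrite fr.
- exists t => //; split; [by rewrite fn|by rewrite fr|].
  by move=> j lt; rewrite fn ?bt // !inE; lia.
Qed.

Lemma ready_select prev e m : ready m -> (size prev < K)%N ->
  ready (den (select prev e) m).
Proof.
move=> rm lt; have [fr fn] := select_frame prev e m.
by apply: ready_frame rm _ _ => r hr; [apply: fr|apply: fn]; move: hr; rewrite !inE; lia.
Qed.

(** Here [x] is any family realising the whole guess. As long as the choices made end no further
    right than those of [x], the next member of [x] is itself eligible; hence the scan cannot fail,
    and its leftmost choice keeps the comparison true. The guess is thus completed and its value
    reached. *)
Lemma members_spec g prev c m : ready m -> selection prev c ->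
  (size prev + size g <= K)%N -> chosen prev c m -> m.2 9%N = profit c ->
  let m' := den (members prev g) m in
  [/\ ready m', m.2 8%N <= m'.2 8%N &
    forall x, selection (prev ++ g) x ->
      (forall j, (j < size prev)%N ->
        xmax (rr (nth 0%N c j)) <= xmax (rr (nth 0%N x j))) ->
      value (prev ++ g) <= m'.2 8%N].
Proof.
elim: g prev c m => [|e g IH] prev c m rm sel leK ch e9.
  rewrite addn0 in leK; have [r8 l8 v8] := accept_spec rm sel leK ch e9.
  by split=> // x; rewrite cats0.
have lt : (size prev < K)%N by move: leK; rewrite /=; lia.
have [dm cm _] := rm.
rewrite -[members _ _]/(Seq _ (Guard _ _ _ (Seq _ (members _ _)))) den_Seq den_Guard.
have lm := select_spec e dm cm lt ch.
have rm1 := ready_select e rm lt.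
have [fr fn] := select_frame prev e m.
set m1 := den (select prev e) m in lm rm1 fr fn *.
have [_ [_ _ c15 _] _] := rm1.
have [sz _ _] := sel.
case: lm => [[h10 no]|[h10 [i [[ltn el sel_i xm_i w_i] mn]]]].
  rewrite c15 h10 ltxx /=; split=> //; first by rewrite fr.
  move=> x selx dom; have el := eligible_dominated sz selx dom.
  have [szx bx _] := selx.
  have := no (nth 0%N x (size prev)); rewrite el => h.
  have /h // : (nth 0 x (size prev) < n)%N.
  by apply: (bx _ _).1; rewrite size_cat /= addnS ltnS leq_addr.
rewrite c15 h10 ltr01 eqxx den_Seq.
set m2 := den _ m1.
have m2E : m2 = (m1.1, upd m1.2 9 (m1.2 9%N + m1.2 11%N)) by [].
have rm2 : ready m2.
  apply: ready_frame rm1 _ _ => r hr //.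
  by rewrite m2E /= updE; case: eqP => // e9'; move: hr; rewrite e9' !inE; lia.
have sel' := selection_rcons sel ltn el.
have [|||r8 l8 v8] := IH (rcons prev e) (rcons c i) m2 rm2 sel'.
- by move: leK; rewrite size_rcons /=; lia.
- move=> j; rewrite size_rcons ltnS leq_eqVlt => /orP[/eqP->|ltj].
    by rewrite nth_rcons sz ltnn eqxx m2E /= updE xm_i sel_i.
  rewrite nth_rcons sz ltj m2E /= updE /=.
  have [<- <-] := ch j ltj.
  by split; [apply: fr; rewrite !inE; lia|apply: fn; rewrite !inE; lia].
- rewrite m2E /= updE eqxx w_i fr // e9 /profit -cats1 big_cat /= big_seq1 //.
split=> //; first by apply: le_trans l8; rewrite m2E /= updE /= fr.
move=> x; rewrite -cat_rcons => selx dom; apply: (v8 _ selx).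
have [szx bx _] := selx.
move=> j; rewrite size_rcons ltnS leq_eqVlt => /orP[/eqP->|ltj].
  rewrite nth_rcons sz ltnn eqxx; apply: mn.
    by apply: (bx _ _).1; rewrite size_cat size_rcons; lia.
  by apply: (eligible_dominated (g := g) sz) => //; rewrite -cat_rcons.
by rewrite nth_rcons sz ltj; exact: dom.
Qed.

Lemma attempts_spec gs m : ready m -> all (fun g : seq entry => (size g <= K)%N) gs ->
  let m' := den (attempts gs) m in
  [/\ ready m', m.2 8%N <= m'.2 8%N &
    forall g x, g \in gs -> selection g x -> value g <= m'.2 8%N].
Proof.
elim: gs m => [|g gs IH] m rm; first by split.
case/andP => leK leKs; rewrite -[attempts _]/(Seq _ (attempts _)) den_Seq /attempt den_Seq.
set m0 := den _ m.
have m0E : m0 = (m.1, upd m.2 9 0) by [].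
have rm0 : ready m0.
  apply: ready_frame rm _ _ => r hr //.
  by rewrite m0E /= updE; case: eqP => // e9; move: hr; rewrite e9 !inE; lia.
have sel0 : selection [::] [::] by split=> // i j; rewrite ltn0 andbF.
have [|||r8 l8 v8] := @members_spec g [::] [::] m0 rm0 sel0.
- by [].
- by [].
- by rewrite m0E /= updE /profit big_nil.
set m1 := den _ m0 in r8 l8 v8 *.
have [r8' l8' v8'] := IH m1 r8 leKs.
split=> //; first by apply: le_trans l8'; exact: le_trans l8.
move=> g' x; rewrite inE => /orP[/eqP->|]; last exact: v8'.
by move=> selx; apply: le_trans l8'; exact: v8 selx _.
Qed.

End Analysis.

(** * Set-up and output *)

Definition copy_cell : stmt := code [:: RLoad 0 6; RStore 4 0; IAdd 4 4 2; IAdd 6 6 2].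

Definition copy_body : stmt :=
  Seq (address 4 3) (Seq (address 6 7) (Seq copy_cell (Seq copy_cell
    (Seq copy_cell (Seq copy_cell copy_cell))))).

(* The input occupies the low real cells, which are the only ones an arithmetic
   instruction can address; it is moved up to make room for the registers. *)
Definition relocate (K : nat) : stmt :=
  Seq (code [:: IConst 7 0; IConst 3 (20 + K); IAdd 3 3 0; IAdd 3 3 0; IAdd 3 3 0;
                IAdd 3 3 0; IAdd 3 3 0])
      (For copy_body).

Definition max_body : stmt := Seq load (Guard true 17 5 (Atom (RMove 17 5))).

(** The base line is put [N] below the lower side of the first rectangle, so that a diameter of at
    most [N] leaves no rectangle below it. For an empty input the base line is arbitrary. The
    maximum weight starts from 0. *)
Definition prologue (N K : nat) : stmt :=
  Seq (relocate K)
 (Seq (code [:: RConst 15 0; RConst 16 1; RConst 17 0; RConst 18 N])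
 (Seq (code [:: IMove 4 3; IAdd 4 4 2; IAdd 4 4 2; RLoad 6 4; RSub 6 6 18])
 (Seq (For max_body)
      (code [:: RConst 18 (2 * K); RDiv 7 17 18; RConst 8 0; IConst 5 0])))).

Definition epilogue (K : nat) : stmt :=
  Seq (Atom (IMove 0 5)) (code [seq IMove j.+1 (11 + 2 * j) | j <- iota 0 K]).

Lemma nat_writes_members prev g r : r \in nat_writes (members prev g) ->
  (r \in [:: 1; 2; 4; 5]%N) || (9 < r)%N.
Proof.
elim: g prev => [|e g IH] prev.
  rewrite -[nat_writes _]/(5%N :: nat_writes (code _)) inE => /orP[/eqP-> //|].
  rewrite /nat_writes swrites_code -map_comp => /flattenP[_ /mapP[i _ ->]].
  by rewrite inE => /eqP->.
rewrite -[nat_writes _]/([:: 1; 2]%N ++ (nat_writes (scan_body prev e) ++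
  nat_writes (members (rcons prev e) g))).
rewrite mem_cat => /orP[|]; first by rewrite !inE; lia.
by rewrite mem_cat => /orP[/nat_writes_scan_body|/IH //]; rewrite !inE; lia.
Qed.

Lemma members_atoms prev g : all_atoms atomic (members prev g).
Proof.
elim: g prev => [|e g IH] prev.
  by rewrite /= all_atoms_code all_map; exact/allP.
rewrite -[all_atoms _ _]/(all_atoms atomic (scan_body prev e) &&
  all_atoms atomic (members (rcons prev e) g)) IH andbT.
by have /andP[] := scan_body_atoms prev e.
Qed.

Lemma members_wf prev g : wf_loops (members prev g).
Proof.
elim: g prev => [|e g IH] prev.
  exact/loop_free_wf/loop_free_code.
rewrite -[wf_loops _]/((loop_free (scan_body prev e) &&
  ~~ has (mem [:: 0; 1; 2]%N) (nat_writes (scan_body prev e))) &&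
  wf_loops (members (rcons prev e) g)) IH andbT.
apply/andP; split; first by rewrite /scan_body /= loop_free_guards.
apply/hasPn => r /(@nat_writes_scan_body prev e); rewrite !inE; lia.
Qed.

Lemma attempts_wf gs : [/\ all_atoms atomic (attempts gs), wf_loops (attempts gs) &
  0%N \notin nat_writes (attempts gs)].
Proof.
elim: gs => [//|g gs [h1 h2 h3]]; split.
- by rewrite /= members_atoms.
- by rewrite /= members_wf.
- rewrite -[nat_writes _]/(nat_writes (members [::] g) ++ nat_writes (attempts gs)).
  by rewrite mem_cat negb_or h3 andbT; apply/negP => /nat_writes_members.
Qed.

Lemma prologue_wf N K : [/\ all_atoms atomic (prologue N K), wf_loops (prologue N K) &
  0%N \notin nat_writes (prologue N K)].
Proof. by []. Qed.

Lemma epilogue_wf K : all_atoms atomic (epilogue K) && loop_free (epilogue K).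
Proof. by rewrite /= all_atoms_code all_map loop_free_code andbT; apply/allP. Qed.

(** * Specifications of the set-up and of the output *)

Section Boundary.
Variables (R : realType) (n K : nat) (rr : nat -> rect R) (ww : nat -> R).
Variable X0 : nat -> R.
Hypothesis X0_stored : forall i, (i < n)%N -> stored_at X0 (5 * i) (rr i) (ww i).
Let B := (20 + K + 5 * n)%N.
Implicit Types (m : memory R).

(** Real cell 0 is also the transfer register, so its input value is granted only until the first
    copy. The other sources survive because the destinations start at [B], beyond the input. *)
Definition copied (a : nat) m : Prop :=
  [/\ forall a', (a' < a)%N -> m.2 (B + a')%N = X0 a',
      forall a', (0 < a' < B)%N -> m.2 a' = X0 a' &
      a = 0%N -> m.2 0%N = X0 0%N].

Lemma den_copy_cell m : den copy_cell m =
  (upd (upd m.1 4 (m.1 4 + m.1 2)%N) 6 (m.1 6 + m.1 2)%N,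
   upd (upd m.2 0 (m.2 (m.1 6%N))) (m.1 4%N) (m.2 (m.1 6%N))).
Proof. by []. Qed.

Definition copy_state (a : nat) m : Prop :=
  [/\ m.1 4%N = (B + a)%N, m.1 6%N = a, m.1 2%N = 1%N & copied a m].

Lemma copy_cell_spec a m : (a < 5 * n)%N -> copy_state a m ->
  copy_state a.+1 (den copy_cell m).
Proof.
move=> lt [h4 h6 h2 [lo hi h0]]; rewrite den_copy_cell h4 h6 h2.
have ma : m.2 a = X0 a.
  by case: a lt {h4 h6 lo} hi h0 => [_ _ ->//|a lt hi _]; apply: hi; rewrite /B; lia.
split; rewrite /= ?updE //=; try lia.
split=> [a' lt'|a' lt'|//] /=; rewrite !updE.
  have [->|ne] := eqVneq a' a; first by rewrite eqxx.
  rewrite eqn_add2l (negPf ne).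
  by case: eqP => [|_]; [rewrite /B; lia|apply: lo; lia].
by case: eqP => [|_]; [lia|case: eqP => [|_]; [lia|exact: hi]].
Qed.

Lemma relocate_spec (W : nat -> nat) : W 0%N = n ->
  let m' := den (relocate K) (W, X0) in
  [/\ m'.1 0%N = n, m'.1 3%N = B, m'.1 2%N = 1%N &
      forall i, (i < n)%N -> stored_at m'.2 (B + 5 * i) (rr i) (ww i)].
Proof.
move=> W0; rewrite /relocate den_Seq.
set m0 := den _ (W, X0).
have m0_0 : m0.1 0%N = n by rewrite -W0.
have m0_7 : m0.1 7%N = 0%N by [].
have m0_3 : m0.1 3%N = B by rewrite /m0 /= /den_instr /= !updE /= W0 /B; lia.
have m0X : m0.2 = X0 by [].
move: m0 m0_0 m0_7 m0_3 m0X => m0 m0_0 m0_7 m0_3 m0X.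
pose I t (mm : memory R) := [/\ mm.1 0%N = n, mm.1 3%N = B, mm.1 7%N = 0%N & mm.1 1%N = t] /\
  mm.1 2%N = 1%N /\ copied (5 * t) mm.
have [] : I (m0.1 0%N) (den (For copy_body) m0).
  apply: for_ind; first by split; [|split=> //; split=> //= *; rewrite m0X].
  rewrite m0_0 => t mm lt [[h0 h3 h7 h1] [h2 cp]].
  have wr r : r \notin [:: 4; 6]%N -> (den copy_body mm).1 r = mm.1 r.
    move=> hr; apply: den_nat => //; apply: contra hr.
    by rewrite /nat_writes /= !inE; lia.
  suff [_ _ _ cp'] : copy_state (5 * t.+1) (den copy_body mm).
    move: (den copy_body mm) wr cp' => mm' wr cp'; rewrite /set_ctr.
    by split; [split; rewrite /= ?updE //= wr|split; rewrite //= ?updE /= wr].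
  rewrite /copy_body (den_Seq (address 4 3)) (den_Seq (address 6 7)) !(den_Seq copy_cell).
  have [m1 m1E] : {m1 | m1 = den (address 4 3) mm} by exists (den (address 4 3) mm).
  have [m2 m2E] : {m2 | m2 = den (address 6 7) m1} by exists (den (address 6 7) m1).
  rewrite -m1E -m2E.
  have -> : (5 * t.+1 = (5 * t).+1.+1.+1.+1.+1)%N by lia.
  do 5 (apply: copy_cell_spec; first by lia).
  have m1_ r : r != 4%N -> m1.1 r = mm.1 r.
    by move=> r4; rewrite m1E; apply: den_nat => //; rewrite /nat_writes /= !inE (negPf r4).
  have m2_ r : r != 6%N -> m2.1 r = m1.1 r.
    by move=> r4; rewrite m2E; apply: den_nat => //; rewrite /nat_writes /= !inE (negPf r4).
  have m2X : m2.2 = mm.2 by rewrite m2E m1E.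
  split.
  - by rewrite m2_ // m1E den_address // h3 h1.
  - by rewrite m2E den_address // !m1_ // h7 h1.
  - by rewrite m2_ // m1_.
  - by case: cp => *; split; rewrite m2X.
rewrite m0_0 => -[h0 h3 _ _] [h2 [lo _ _]]; split=> // i lt.
have [s1 s2 s3 s4 s5] := X0_stored lt.
by split; rewrite -1?[(B + 5 * i + _)%N]addnA lo //; lia.
Qed.

(** This is the maximum of 0 and the first [t] weights. *)
Definition is_max (t : nat) (M : R) : Prop :=
  [/\ 0 <= M, forall i, (i < t)%N -> ww i <= M &
      M = 0 \/ exists2 i, (i < t)%N & ww i = M].

Lemma max_spec m : data n B rr ww m -> m.2 17%N = 0 ->
  let m' := den (For max_body) m in
  [/\ data n B rr ww m', is_max n (m'.2 17%N) &
      forall r, r \in [:: 6; 15; 16]%N -> m'.2 r = m.2 r].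
Proof.
move=> dm e17.
have wn r : r \notin [:: 1; 2; 4]%N -> (den (For max_body) m).1 r = m.1 r.
  move=> hr; apply: den_nat => //; apply: contra hr.
  by rewrite /nat_writes /= !inE; lia.
have wr r : r \notin [:: 1; 2; 3; 4; 5; 17]%N -> (den (For max_body) m).2 r = m.2 r.
  by move=> hr; apply: den_real.
pose I t (mm : memory R) := [/\ data n B rr ww mm, mm.1 1%N = t, mm.1 2%N = 1%N &
  is_max t (mm.2 17%N)].
have n0 : m.1 0%N = n by case: dm.
have : I (m.1 0%N) (den (For max_body) m).
  apply: for_ind.
    by split=> //=; rewrite e17; split=> //; left.
  rewrite n0 => t mm lt [dmm h1 h2 [M0 Mle Mex]].
  have Bge : (20 + K <= B)%N by rewrite /B leq_addr.
  have [_ _ _ _ l5] := den_load Bge dmm h1 h2 lt.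
  have lr : forall r, r \notin [:: 1; 2; 3; 4; 5]%N -> (den load mm).2 r = mm.2 r.
    by move=> r hr; apply: den_real.
  have ln : forall r, r != 4%N -> (den load mm).1 r = mm.1 r.
    by move=> r r4; apply: den_nat => //; rewrite /nat_writes /= !inE !negb_or r4.
  rewrite /max_body (den_Seq load).
  move: (den load mm) l5 lr ln => m2 l5 lr ln; rewrite den_Guard lr // l5.
  case: dmm => d0 d3 dd.
  have dat (X : nat -> R) : (forall r, (20 <= r)%N -> X r = mm.2 r) ->
      data n B rr ww (upd m2.1 1 t.+1, X).
    move=> hX; split; rewrite /= ?updE /= ?ln //.
    move=> i /dd; rewrite /stored_at => -[s1 s2 s3 s4 s5].
    by split; rewrite hX //; lia.
  have big r : (20 <= r)%N -> m2.2 r = mm.2 r.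
    by move=> hr; apply: lr; rewrite !inE; lia.
  case: ltP => cmp; rewrite /set_ctr /=; split=> //=; rewrite ?updE /= ?ln //.
  - apply: dat => r hr; rewrite updE.
    by have /negPf-> : r != 17%N; [lia|exact: big].
  - rewrite l5; split; first by apply: ltW; exact: le_lt_trans cmp.
      move=> i; rewrite ltnS leq_eqVlt => /orP[/eqP->//|/Mle h].
      exact: le_trans h (ltW cmp).
    by right; exists t.
  - exact: dat.
  - rewrite lr //; split=> //.
      by move=> i; rewrite ltnS leq_eqVlt => /orP[/eqP->//|/Mle].
    by case: Mex => [|[i lti e]]; [left|right; exists i => //; exact: ltnW].
rewrite n0 => -[dm' _ _ mx]; split=> // r; rewrite !inE => hr.
by apply: wr; rewrite !inE; lia.
Qed.

Lemma prologue_spec (W : nat -> nat) N : W 0%N = n ->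
  exists y0 M, [/\ (0 < n)%N -> y0 = ymin (rr 0%N) - N%:R, is_max n M,
    ready n B K rr ww y0 (M / (2 * K)%:R) (den (prologue N K) (W, X0)) &
    (den (prologue N K) (W, X0)).2 8%N = 0].
Proof.
move=> W0; have [r0 r3 r2 rs] := relocate_spec W0.
rewrite /prologue (den_Seq (relocate K)).
move: (den (relocate K) _) r0 r3 r2 rs => m r0 r3 r2 rs.
set c1 := code _; set c2 := code _; set c3 := code _.
rewrite (den_Seq c1) (den_Seq c2) (den_Seq (For max_body)).
have a1 : (den c1 m).1 = m.1 by [].
have [a15 [a16 [a17 a18]]] : (den c1 m).2 15%N = 0 /\ (den c1 m).2 16%N = 1 /\
  (den c1 m).2 17%N = 0 /\ (den c1 m).2 18%N = N%:R by [].
have ar r : (20 <= r)%N -> (den c1 m).2 r = m.2 r.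
  by move=> hr; apply: den_real => //; rewrite /real_writes /= !inE; lia.
move: (den c1 m) a1 a15 a16 a17 a18 ar => m1 a1 a15 a16 a17 a18 ar.
have b6 : (den c2 m1).2 6%N = m1.2 (m1.1 3%N + m1.1 2%N + m1.1 2%N)%N - m1.2 18%N by [].
have br r : r != 6%N -> (den c2 m1).2 r = m1.2 r.
  by move=> hr; apply: den_real => //; rewrite /real_writes /= !inE (negPf hr).
have bn r : r != 4%N -> (den c2 m1).1 r = m1.1 r.
  by move=> hr; apply: den_nat => //; rewrite /nat_writes /= !inE (negPf hr).
move: (den c2 m1) b6 br bn => m2 b6 br bn.
have dm2 : data n B rr ww m2.
  split; rewrite ?bn // ?a1 // => i /rs; rewrite /stored_at => -[s1 s2 s3 s4 s5].
  have Bge : (20 <= B)%N by rewrite /B -addnA leq_addr.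
  by split; rewrite br ?ar //; lia.
have [|dm3 mx fr] := max_spec dm2; first by rewrite br.
exists (m2.2 6%N), ((den (For max_body) m2).2 17%N).
move: (den (For max_body) m2) dm3 mx fr => m3 dm3 mx fr.
have e8 : (den c3 m3).2 8%N = 0 by [].
have e7 : (den c3 m3).2 7%N = m3.2 17%N / (2 * K)%:R by [].
have e5 : (den c3 m3).1 5%N = 0%N by [].
have er r : r \notin [:: 18; 7; 8]%N -> (den c3 m3).2 r = m3.2 r.
  by move=> hr; apply: den_real.
have en r : r != 5%N -> (den c3 m3).1 r = m3.1 r.
  by move=> hr; apply: den_nat => //; rewrite /nat_writes /= !inE (negPf hr).
move: (den c3 m3) e8 e7 e5 er en => m4 e8 e7 e5 er en.
split=> //.
- move=> n0; rewrite b6 a18 a1 r3 r2 -addnA.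
  have [_ _ s3 _ _] := rs 0%N n0; rewrite muln0 addn0 in s3.
  by rewrite ar ?s3 //; rewrite /B; lia.
- split.
  + case: dm3 => d0 d3 dd; split; rewrite ?en // => i /dd.
    have Bge : (20 <= B)%N by rewrite /B -addnA leq_addr.
    rewrite /stored_at => -[s1 s2 s3 s4 s5].
    by split; rewrite er // !inE; lia.
  + by split; rewrite // er // fr // br.
  + exists [::]; first by [].
    by split; rewrite // e8 /profit big_nil.
Qed.

Lemma epilogue_spec y0 delta m : ready n B K rr ww y0 delta m ->
  exists2 t, valid n rr t & let m' := den (epilogue K) m in
    [/\ m'.1 0%N = size t, m.2 8%N = profit ww t &
        [seq m'.1 j | j <- iota 1 (m'.1 0%N)] = t].
Proof.
move=> [_ _ [t [vt leK] [b5 b8 bt]]]; exists t => //.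
rewrite /epilogue den_Seq.
set m0 := den (Atom _) m; set cp := code _.
have m0_0 : m0.1 0%N = size t by rewrite -b5.
have m0_ r : r != 0%N -> m0.1 r = m.1 r.
  by move=> /negPf hr; rewrite /m0 /= /den_instr /= updE hr.
have [||_ e1] := @den_copy R (fun j => j.+1) (fun j => 11 + 2 * j)%N 0 K m0.
- by move=> i j _ lt; lia.
- by move=> i j [].
have h0 : (den cp m0).1 0%N = size t.
  rewrite den_nat ?m0_0 // /cp ?all_atoms_code ?all_map; first exact/allP.
  rewrite /nat_writes swrites_code -map_comp; apply/flattenP => -[_ /mapP[i _ ->]].
  by rewrite inE.
split=> //; rewrite /= -/cp h0.
apply: (@eq_from_nth _ 0%N) => [|j]; rewrite size_map size_iota // => lt.
rewrite (nth_map 0%N) ?size_iota // nth_iota // add1n e1 ?add0n; last first.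
  exact: leq_trans leK.
by rewrite m0_ // bt.
Qed.

End Boundary.

(** * Approximation guarantee *)

Fixpoint words (T : Type) (A : seq T) (k : nat) : seq (seq T) :=
  if k is k'.+1 then [::] :: [seq a :: u | a <- A, u <- words A k'] else [:: [::]].

Lemma mem_words (T : eqType) (A u : seq T) k :
  (size u <= k)%N -> {subset u <= A} -> u \in words A k.
Proof.
elim: k u => [|k IH] [|a u] //= lt sub; rewrite inE /=.
apply/allpairsP; exists (a, u) => /=; split=> //.
  by apply: sub; rewrite inE eqxx.
by apply: IH => // b bu; apply: sub; rewrite inE bu orbT.
Qed.

Lemma size_words (T : eqType) (A : seq T) k :
  all (fun u => size u <= k)%N (words A k).
Proof.
elim: k => [//|k IH] /=; apply/allP => _ /allpairsP[[a u] [_ /= uw ->]].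
exact: (allP IH).
Qed.

(** Relative to the base line all y-ranges lie in a window of height [2 * N]; the upper bound is
    exclusive, whence one more value for it. A weight of at most [M] is at most [2 * K] units
    [delta]. *)
Definition entries (N K : nat) : seq entry :=
  [seq (pq, l) | pq <- [seq (p, q) | p <- iota 0 (2 * N).+1, q <- iota 0 (2 * N).+2],
                 l <- iota 0 (2 * K).+1].

Lemma mem_entries N K p q l : (p <= 2 * N)%N -> (q <= (2 * N).+1)%N ->
  (l <= 2 * K)%N -> ((p, q), l) \in entries N K.
Proof.
move=> hp hq hl; apply: allpairs_f; last by rewrite mem_iota.
by apply: allpairs_f; rewrite mem_iota.
Qed.

Section Approximation.
Variable R : realType.

Definition rect0 : rect R := Rect 0 0 0 0.

Definition fields (w : rect R -> R) (r : rect R) : seq R :=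
  [:: xmin r; xmax r; ymin r; ymax r; w r].

Lemma input_stored (s : seq (rect R)) w i : (i < size s)%N ->
  stored_at (nth 0 (flatten [seq fields w r | r <- s])) (5 * i)
    (nth rect0 s i) (w (nth rect0 s i)).
Proof.
elim: s i => [//|r s IH] [_|i lt]; first by split.
by rewrite mulnS; have [] := IH i lt; split.
Qed.

(** * The guess made from a conflict-free family *)

Section Guess.
Variables (N K : nat) (y0 M : R) (s : seq (rect R)) (w : rect R -> R).
Let rr i := nth rect0 s i.
Let ww i := w (rr i).
Let delta := M / (2 * K)%:R.
Hypotheses (K_gt0 : (0 < K)%N) (M_gt0 : 0 < M).
Hypothesis s_fat : all (@fat R) s.
Hypothesis w_le : {in s, forall r, w r <= M}.
Hypothesis y_bounds : {in s, forall r, 0 <= ymin r - y0 /\ ymax r - y0 <= (2 * N)%:R}.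

Let delta_gt0 : 0 < delta.
Proof. by rewrite divr_gt0 // ltr0n muln_gt0. Qed.

Let delta_K : delta * (2 * K)%:R = M.
Proof. by rewrite divfK // pnatr_eq0 muln_eq0 /= -lt0n. Qed.

Definition guess (r : rect R) : entry :=
  ((Num.truncn (ymin r - y0), (Num.truncn (ymax r - y0)).+1),
   Num.truncn (w r / delta)).

Lemma guess_entries r : r \in s -> 0 <= w r -> guess r \in entries N K.
Proof.
move=> rs w0; have [y1 y2] := y_bounds rs.
have fr := allP s_fat r rs; rewrite /fat /width /height in fr.
apply: mem_entries; rewrite ?ltnS truncn_le_nat -natr1.
- lra.
- lra.
- rewrite ltr_pdivrMr // mulrDl mul1r mulrC delta_K.
  by apply: le_lt_trans (w_le rs) _; rewrite ltrDl.
Qed.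

(** Rounding down moves a coordinate by less than 1, so tightness yields both vertical inequalities
    of [vconflict]. Without a conflict the x-ranges must then be disjoint, and the order of the
    right sides tells which comes first. *)
Lemma guess_tight r q : r \in s -> q \in s -> xmax r <= xmax q ->
  tight (guess r) (guess q) -> ~~ vconflict r q -> xmax r < xmin q.
Proof.
move=> rs qs le; rewrite /tight /guess /= !ltnS => /andP[t1 t2] nv.
have [y1 _] := y_bounds rs; have [y2 _] := y_bounds qs.
have fr := allP s_fat r rs; have fq := allP s_fat q qs.
rewrite /fat /width /height in fr fq.
move: t1; rewrite truncn_ge_nat; last by lra.
move: t2; rewrite truncn_ge_nat; last by lra.
have := truncnS_gt (ymin r - y0); have := truncnS_gt (ymin q - y0).
rewrite -!natr1 => h1 h2 h3 h4; rewrite ltNge; apply/negP => h.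
move/negP: nv; apply; rewrite /vconflict /xoverlap.
by apply/and3P; split; [apply/andP; split|..]; lra.
Qed.

Lemma guess_box r : r \in s -> 0 <= w r ->
  [/\ (guess r).1.1%:R + y0 <= ymin r, ymax r < (guess r).1.2%:R + y0,
      (guess r).2%:R * delta <= w r & w r <= (guess r).2%:R * delta + delta].
Proof.
move=> rs w0; have [y1 y2] := y_bounds rs; rewrite /guess /=.
have := truncn_le (ymin r - y0); rewrite y1 => h1.
have h2 := truncnS_gt (ymax r - y0).
have := truncn_le (w r / delta); rewrite (divr_ge0 w0 (ltW delta_gt0)) => h3.
have := truncnS_gt (w r / delta); rewrite ltr_pdivrMr // -natr1 mulrDl mul1r => h4.
split; [lra|lra| |exact: ltW].
by rewrite -ler_pdivlMr.
Qed.

(** Rounding down loses at most [delta] on each of at most [K] members, and [K * delta] is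
    [M / 2]. *)
Lemma good_guess (Y : seq (rect R)) : uniq Y -> {subset Y <= s} ->
  (size Y <= K)%N -> {in Y, forall r, 0 <= w r} ->
  {in Y &, forall r q, r != q -> ~~ vconflict r q} ->
  exists g x, [/\ g \in words (entries N K) K,
    selection (size s) rr ww y0 delta g x &
    \sum_(r <- Y) w r - M / 2 <= value delta g].
Proof.
move=> uY sub szY w0 nv.
pose le (r q : rect R) := xmax r <= xmax q.
have le_tot : total le by move=> r q; exact: le_total.
have le_tr : transitive le by move=> r q p; exact: le_trans.
(* Members are listed by increasing right side, the order that [guess_tight] requires. *)
pose Z := sort le Y.
have mZ : Z =i Y by exact: mem_sort.
have szZ : size Z = size Y by rewrite size_sort.
have uZ : uniq Z by rewrite sort_uniq.
have sZ : sorted le Z by exact: sort_sorted.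
exists [seq guess r | r <- Z], [seq index r s | r <- Z].
have subZ r : r \in Z -> r \in s by rewrite mZ; exact: sub.
have w0Z r : r \in Z -> 0 <= w r by rewrite mZ; exact: w0.
have nthx j : (j < size Z)%N -> rr (nth 0%N [seq index r s | r <- Z] j) = nth rect0 Z j.
  by move=> lt; rewrite (nth_map rect0) // /rr nth_index // subZ // mem_nth.
have nthg j : (j < size Z)%N -> nth entry0 [seq guess r | r <- Z] j = guess (nth rect0 Z j).
  by move=> lt; rewrite (nth_map rect0).
split.
- apply: mem_words; first by rewrite size_map szZ.
  by move=> _ /mapP[r rZ ->]; apply: guess_entries; [exact: subZ|exact: w0Z].
- split; first by rewrite !size_map.
    move=> j; rewrite size_map => lt; have zs := mem_nth rect0 lt.
    split; first by rewrite (nth_map rect0) // index_mem subZ.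
    rewrite /box /ww nthx // nthg //.
    by have [-> -> -> _] := guess_box (subZ _ zs) (w0Z _ zs).
  move=> i j /andP[ij]; rewrite size_map => lt; have lti := ltn_trans ij lt.
  rewrite !nthx // !nthg // => t.
  apply: guess_tight t _; try by apply: subZ; exact: mem_nth.
    by apply: (sorted_leq_nth le_tr _ _ sZ) => //; [move=> ?; exact: lexx|exact: ltnW].
  apply: nv; rewrite -?mZ ?mem_nth //.
  by rewrite nth_uniq // neq_ltn ij.
- rewrite /value big_map -(perm_big _ (permEl (perm_sort le Y))) /= -/Z.
  have : \sum_(r <- Z) w r <= \sum_(r <- Z) ((guess r).2%:R * delta + delta).
    rewrite big_seq [leRHS]big_seq; apply: ler_sum => r rZ.
    by have [] := guess_box (subZ _ rZ) (w0Z _ rZ).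
  rewrite big_split /= big_const_seq count_predT iter_addr_0 szZ => h.
  have hK : delta * (size Y)%:R <= delta * K%:R.
    by apply: ler_wpM2l; [exact: ltW delta_gt0|rewrite ler_nat].
  have hM := delta_K; rewrite natrM in hM; rewrite -mulr_natr in h.
  lra.
Qed.

End Guess.

(** * From an arbitrary independent set to a guess *)

Section Correctness.
Variables (N : nat) (S : {fset rect R}) (w : rect R -> R) (s : seq (rect R)).
Hypotheses (sS : perm_eq s S) (S_diam : diam S <= N%:R).
Hypothesis S_fat : {in S, forall r, 1 <= width r /\ 1 <= height r}.
Let rr i := nth rect0 s i.
Let ww i := w (rr i).
Let K := ((2 * N).+1 * (2 * N).+1)%N.

Let mem_s : s =i S.
Proof. exact: perm_mem sS. Qed.

Let s_uniq : uniq s.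
Proof. by rewrite (perm_uniq sS) fset_uniq. Qed.

Let s_fat : all (@fat R) s.
Proof. by apply/allP => r; rewrite mem_s => /S_fat[h1 h2]; apply/andP. Qed.

Let bounds r q : r \in s -> q \in s ->
  `|xmax r - xmin q| <= N%:R /\ `|ymax r - ymin q| <= N%:R.
Proof.
rewrite !mem_s => rS qS; have [h1 h2] := diam_bounds rS qS.
by split; apply: le_trans S_diam.
Qed.

(** If no weight is positive, every independent set has weight at most 0. Otherwise the guess is
    made from a heavy conflict-free class or, should this weigh less than [M], from the heaviest
    rectangle alone. *)
Lemma independent_sparse (J : {fset rect R}) M y0 : independent S J ->
  is_max ww (size s) M -> ((0 < size s)%N -> y0 = ymin (rr 0%N) - N%:R) ->
  weight w J <= 0 \/ exists g x, [/\ g \in words (entries N K) K,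
    selection (size s) rr ww y0 (M / (2 * K)%:R) g x &
    weight w J <= 6 * value (M / (2 * K)%:R) g].
Proof.
move=> [/fsubsetP JS Jind] [M0 wM Mex] y0E.
have w_le : {in s, forall r, w r <= M}.
  move=> r rs; have := wM (index r s); rewrite index_mem => /(_ rs).
  by rewrite /ww /rr nth_index.
have [M_le0|M_gt0] := lerP M 0.
  left; rewrite /weight big_seq; apply: sumr_le0 => r /JS.
  by rewrite -mem_s => /w_le h; exact: le_trans h M_le0.
right; case: Mex => [e|[i0 lt0 wi0]]; first by rewrite e ltxx in M_gt0.
have n_gt0 : (0 < size s)%N by exact: leq_ltn_trans lt0.
have {}y0E := y0E n_gt0.
have r0s : rr 0%N \in s by exact: mem_nth.
have y_bounds : {in s, forall r, 0 <= ymin r - y0 /\ ymax r - y0 <= (2 * N)%:R}.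
  move=> r rs; have [_] := bounds r0s rs; have [_] := bounds rs r0s.
  have := allP s_fat _ r0s; rewrite /fat /width /height => f0.
  by rewrite !ler_norml y0E natrM => h1 h2; split; lra.
have K0 : (0 < K)%N by [].
(* As [M] is at most the weight of [Y], the loss [M / 2] is at most half of that weight, which turns
   the factor 3 into 6. *)
have from_class (Y : seq (rect R)) : uniq Y -> {subset Y <= s} ->
    (size Y <= K)%N -> {in Y, forall r, 0 <= w r} ->
    {in Y &, forall r q, r != q -> ~~ vconflict r q} ->
    M <= \sum_(r <- Y) w r -> weight w J <= 3 * \sum_(r <- Y) w r ->
    exists g x, [/\ g \in words (entries N K) K,
    selection (size s) rr ww y0 (M / (2 * K)%:R) g x &
    weight w J <= 6 * value (M / (2 * K)%:R) g].
  move=> uY sub szY w0 nv MY JY.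
  have [g [x [gw sel le]]] := good_guess K0 M_gt0 s_fat w_le y_bounds uY sub szY w0 nv.
  by exists g, x; split=> //; lra.
have Js : {subset J <= s} by move=> r /JS; rewrite mem_s.
have J_fat : all (@fat R) J by apply/allP => r /Js; exact: (allP s_fat).
have J_sep : {in J &, forall r q, r != q -> separated r q}.
  move=> r q rJ qJ rq; apply: not_intersects_separated; [exact: (allP J_fat)|exact: (allP J_fat)|].
  by move=> int; apply: (Jind r q rJ qJ); split=> //; [exact: JS|exact: JS|exact/eqP].
have [Y [Ysub w0 nv] JY] := heavy_conflict_free w (fset_uniq J) J_fat J_sep.
have YJ : {subset Y <= J} by exact: mem_subseq.
have uY : uniq Y by exact: subseq_uniq Ysub (fset_uniq J).
have [MY|YM] := lerP M (\sum_(r <- Y) w r).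
  apply: (from_class Y) => //; first by move=> r /YJ /Js.
  (* Each upper right corner is within [N], in both coordinates, of the lower left corner of the
     first rectangle. The offsets are therefore at most [2 * N], and the strict bound of
     [packing_bound] asks for one more. *)
  apply: (@packing_bound R _ (xmin (rr 0%N) - N%:R) y0) => //.
  - by apply/allP => r /YJ; exact: (allP J_fat).
  - by move=> r q /YJ rJ /YJ qJ; exact: J_sep.
  - move=> r /YJ /Js rs; have [] := bounds rs r0s; have [] := bounds r0s rs.
    have := allP s_fat _ r0s; have := allP s_fat _ rs; rewrite /fat /width /height => fr f0.
    by rewrite !ler_norml y0E -natr1 natrM => h1 h2 h3 h4; split; lra.
(* A class lighter than [M] is replaced by a single rectangle of weight [M]. *)
apply: (from_class [:: rr i0]) => //.
- by move=> r; rewrite inE => /eqP->; exact: mem_nth.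
- by move=> r; rewrite inE => /eqP->; rewrite -[w _]/(ww i0) wi0.
- by move=> r q; rewrite !inE => /eqP-> /eqP->; rewrite eqxx.
- by rewrite big_seq1 -wi0.
- rewrite big_seq1 -[w _]/(ww i0) wi0; apply: le_trans JY _; lra.
Qed.

Lemma valid_outputs t (c : config R) : valid (size s) rr t ->
  [seq nats c j | j <- iota 1 (nats c 0)] = t ->
  exists I : {fset rect R}, [/\ outputs s c I, independent S I &
    weight w I = profit ww t].
Proof.
move=> [ut lt sep] ct; exists [fset r | r in [seq rr i | i <- t]]%fset.
have u : uniq [seq rr i | i <- t].
  rewrite map_inj_in_uniq // => i j /lt li /lt lj /eqP.
  by rewrite nth_uniq // => /eqP.
have p : perm_eq [seq rr i | i <- t] [fset r | r in [seq rr i | i <- t]]%fset.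
  by apply: uniq_perm => [//||r]; [exact: fset_uniq|rewrite !inE].
split.
- exists [seq rr i | i <- t] => //.
  rewrite (map_comp (onth s) (nats c)) ct -map_comp; apply/eq_in_map => i /lt li /=.
  by rewrite onthE (nth_map rect0).
- split.
    by apply/fsubsetP => r; rewrite -(perm_mem p) => /mapP[i /lt li ->]; rewrite -mem_s mem_nth.
  move=> r q; rewrite -!(perm_mem p) => /mapP[i it ->] /mapP[j jt ->] [_ _ ne].
  apply: separated_not_intersects; apply: sep => //.
  by apply/eqP => e; apply: ne; rewrite e.
- by rewrite /weight -(perm_big _ p) big_map.
Qed.

End Correctness.

End Approximation.

(** * The whole program, its running time and its guarantee *)

Definition algorithm (N : nat) : stmt :=
  let K := ((2 * N).+1 * (2 * N).+1)%N in
  Seq (prologue N K) (attempts (words (entries N K) K)).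

Definition independent_set_program (N : nat) : program :=
  compile 0 (Seq (algorithm N) (epilogue ((2 * N).+1 * (2 * N).+1))).

(** Everything before the epilogue leaves [nats[0]] alone and costs at most a multiple of [n.+1].
    The epilogue overwrites that cell but is free of loops, so its cost is the constant [b]. *)
Lemma program_terminates (R : realType) N : exists a b, forall n (m : memory R), m.1 0%N = n ->
  let m' := den (epilogue ((2 * N).+1 * (2 * N).+1)) (den (algorithm N) m) in
  exists p, run (independent_set_program N) (a * n.+1 + b) (Config 0 m.1 m.2) =
    Some (Config p m'.1 m'.2).
Proof.
set K := ((2 * N).+1 * (2 * N).+1)%N.
have [p1 p2 p3] := prologue_wf N K.
have [q1 q2 q3] := attempts_wf (words (entries N K) K).
have at1 : all_atoms atomic (algorithm N) by apply/andP.
have wf1 : wf_loops (algorithm N) by apply/andP.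
have nw1 : 0%N \notin nat_writes (algorithm N).
  have -> : nat_writes (algorithm N) = nat_writes (prologue N K) ++
    nat_writes (attempts (words (entries N K) K)) by [].
  by rewrite mem_cat negb_or p3.
have [a ha] := wf_loops_cost wf1.
have /andP[at2 lf2] := epilogue_wf K.
exists a, (cost (epilogue K) 0) => n m m0 m'.
have cAt : code_at (independent_set_program N) 0
    (compile 0 (algorithm N) ++ compile (len (algorithm N)) (epilogue K)) by [].
have h1 := @compile_correct R _ _ _ m at1 wf1 _ (code_at_catl cAt).
have := code_at_catr cAt; rewrite size_compile => c2.
have h2 := @compile_correct R _ _ _ (den (algorithm N) m) at2 (loop_free_wf lf2) _ c2.
have [||t lt e] := reaches_trans (h1 _) (h2 _); rewrite ?nw1 ?lf2 ?orbT //.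
exists (0 + len (algorithm N) + len (epilogue K))%N.
apply: run_stepn e _.
  apply: leq_trans lt _; rewrite m0; apply: leq_add; first exact: ha.
  by rewrite (loop_free_cost _ 0 lf2).
(* The program counter has reached the end of the text, where [nth] yields [Halt]. *)
by rewrite /step nth_default // /independent_set_program size_compile.
Qed.


Theorem theorem7 (R : realType) (D : R) :
  exists (P : program) (T : nat -> nat),
    (fun n : nat => (T n)%:R : R) =O_\oo (fun n : nat => n%:R : R) /\
    forall (S : {fset rect R}) (w : rect R -> R) (s : seq (rect R)),
      perm_eq s S ->
      diam S <= D ->
      {in S, forall r, 1 <= width r /\ 1 <= height r} ->
      exists c : config R, run P (T #|` S|%fset) (input s w) = Some c /\
        exists I : {fset rect R},
          [/\ outputs s c I,
              independent S I &
              forall OPT : {fset rect R}, max_independent S w OPT ->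
                weight w OPT <= 6 * weight w I].
Proof.
(* A natural number above [D]; the program depends on [D] through it alone. *)
pose N := (Num.truncn D).+1.
have [a [b runs]] := program_terminates R N.
exists (independent_set_program N), (fun n => a * n.+1 + b)%N; split.
  (* For [n] at least 1, [a * n.+1 + b] is at most [(2 * a + b) * n]; the successor makes the
     constant positive. *)
  apply/eqO_exP; exists (2 * a + b).+1%:R; first by rewrite ltr0n.
  near=> n; rewrite !ger0_norm // -natrM ler_nat.
  have : (0 < n)%N by near: n; exists 1%N.
  by nia.
move=> S w s sS dS fS; rewrite -(perm_size sS).
have S_diam : diam S <= N%:R by apply: le_trans dS _; apply/ltW/truncnS_gt.
set n := size s.
pose K := ((2 * N).+1 * (2 * N).+1)%N.
pose rr i := nth (rect0 R) s i; pose ww i := w (rr i).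
pose m : memory R := (nats (input s w), reals (input s w)).
have m0 : m.1 0%N = n by [].
have [p e] := runs n m m0.
have rr_fat i : (i < n)%N -> fat (rr i).
  by move=> lt; have [|h1 h2] := fS (rr i); [rewrite -(perm_mem sS) mem_nth|apply/andP].
have stored i (lt : (i < n)%N) := input_stored w lt.
have [y0 [M [y0E mx rdy e8]]] := prologue_spec K stored N m0.
have B_ge : (20 + K <= 20 + K + 5 * n)%N by exact: leq_addr.
have [rdy' l8 best8] := attempts_spec B_ge rr_fat rdy (size_words (entries N K) K).
have [t vt [h0 h8 ht]] := epilogue_spec rdy'.
pose m' := den (epilogue K) (den (algorithm N) m).
have [I [out ind wI]] := valid_outputs w sS (c := Config p m'.1 m'.2) vt ht.
eexists; split; first exact: e.
exists I; split=> // J [Jind _].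
(* The best weight starts at 0, that of the empty set, and never decreases. This settles the case in
   which [J] has weight at most 0. *)
have V0 : 0 <= weight w I by rewrite wI -h8 -e8.
have [J0|[g [x [gw sel le]]]] := independent_sparse sS S_diam fS Jind mx y0E.
  by apply: le_trans J0 _; rewrite mulr_ge0.
apply: le_trans le _; rewrite ler_pM2l // wI -h8.
exact: best8 gw sel.
Unshelve. all: by end_near.
Qed.
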